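(* Among the $105$ trivalent trees with six leaves labeled by $x^2, xy, y^2, yz, z^2, xz$, exactly $14$ are realizable by a pencil of conics. Twelve of these are caterpillar trees and two of them are snowflake trees.
   Context: Tropical arithmetic: $x\oplus y=\min\{x,y\}$, $x\odot y=x+y$ on $\mathbb{R}$. Tropical projective space is $\mathbb{TP}^{m-1}=\mathbb{R}^m/\mathbb{R}(1,\dots,1)$. A point $a=(a_1,\dots,a_6)\in\mathbb{TP}^5$ is identified with the tropical conic given by $F_a(x,y,z)=\min\{a_1+2x,\;a_2+x+y,\;a_3+2y,\;a_4+y+z,\;a_5+2z,\;a_6+x+z\}$; a point $(x,y,z)\in\mathbb{TP}^2$ lies on the conic if this minimum is attained at least twice. The coordinates $a_1,\dots,a_6$ are thus labeled by $x^2,xy,y^2,yz,z^2,xz$ respectively. For a real $k\times k$ matrix $A=(a_{ij})$, the tropical determinant is $\min_{\sigma\in S_k}(a_{1\sigma_1}+\dots+a_{k\sigma_k})$; $A$ is tropically singular if this minimum is attained by at least two permutations. Let $P_i=(x_i,y_i,z_i)\in\mathbb{TP}^2$, $1\le i\le 4$, be four points such that all $4\times4$ submatrices of the $4\times 6$ matrix with rows $(2x_i,\,x_i+y_i,\,2y_i,\,y_i+z_i,\,2z_i,\,x_i+z_i)$ are tropically nonsingular (genericity). Then the set of all $a\in\mathbb{TP}^5$ whose conic passes through $P_1,\dots,P_4$ is a tropical line in $\mathbb{TP}^5$, called the pencil of conics. A tropical line in $\mathbb{TP}^{5}$ is an embedded tree whose edges are bounded segments or unbounded half rays, such that all edge directions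 are spanned by integer vectors, there are precisely six unbounded half rays and their directions are the six coordinate directions $e_1,\dots,e_6$, and at every vertex the primitive integer vectors of the outgoing edges sum to $0$. Regarding the half rays as leaves, with the half ray in direction $e_i$ labeled by the monomial of the coordinate $a_i$, the line is a tree with six labeled leaves. A tree $\Gamma$ with leaves labeled $x^2,xy,y^2,yz,z^2,xz$ is realizable by a pencil of conics if there is a configuration of four points $P_i=(x_i,y_i,z_i)\in\mathbb{TP}^2$, $1\le i\le 4$, for which all $4\times4$ submatrices of the $4\times 6$ matrix with rows $(2x_i,\,x_i+y_i,\,2y_i,\,y_i+z_i,\,2z_i,\,x_i+z_i)$ are tropically nonsingular, and whose pencil of conics is combinatorially (as a leaf-labeled tree) equal to $\Gamma$. A trivalent tree with six labeled leaves has four internal vertices, each of degree three. It is a caterpillar tree if each of the four internal vertices is adjacent to at least one leaf ($90$ such labeled trees), and a snowflake tree if some internal vertex is not adjacent to any leaf ($15$ such labeled trees). *)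

(* Defs.v *)
From HB Require Import structures.
From mathcomp Require Import all_boot all_order all_algebra all_fingroup.
From mathcomp Require Import boolp classical_sets reals.

Set Implicit Arguments.
Unset Strict Implicit.
Unset Printing Implicit Defensive.

Import Order.TTheory GRing.Theory Num.Theory.
Local Open Scope ring_scope.

(* Trees with n labeled leaves [inl i] and internal vertices [inr v], v : V;  *)
(* a graph is stored as the set of its oriented edges.                        *)
Section LabeledTrees.
Variables (n : nat) (V : finType).

Definition vertex : finType := ('I_n + V)%type.
Definition lgraph : finType := {set vertex * vertex}.

Definition adj (E : lgraph) : rel vertex := [rel u w | (u, w) \in E].

Definition acyclic (e : rel vertex) : Prop :=
  forall c : seq vertex, ucycle e c -> (size c <= 2)%N.

Definition is_tree (E : lgraph) : Prop :=
  [/\ symmetric (adj E), irreflexive (adj E),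
      forall u w, connect (adj E) u w & acyclic (adj E)].

Definition degree (E : lgraph) (u : vertex) : nat :=
  #|[set w | adj E u w]%SET|.

Definition labeled_tree (E : lgraph) : Prop :=
  is_tree E /\ forall i, degree E (inl i) = 1%N.

Definition relabel (s : {perm V}) (u : vertex) : vertex :=
  match u with inl i => inl i | inr v => inr (s v) end.

(* Isomorphisms fix the leaves. *)
Definition tree_iso : rel lgraph := fun E F =>
  [exists s : {perm V}, forall u, forall w,
     adj E u w == adj F (relabel s u) (relabel s w)].

Definition caterpillar (E : lgraph) : Prop :=
  forall v, exists i, adj E (inr v) (inl i).

Definition snowflake (E : lgraph) : Prop :=
  exists v, forall i, ~~ adj E (inr v) (inl i).

(* The number of isomorphism classes of graphs with property Q. *)
Definition num_classes (Q : lgraph -> Prop) : nat :=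
  #|equivalence_partition tree_iso [set E | `[< Q E >]]%SET|.

End LabeledTrees.

Definition trivalent6 (E : lgraph 6 'I_4) : Prop :=
  labeled_tree E /\ forall v, degree E (inr v) = 3%N.

Section TropicalLines.
Variables (R : realType) (n : nat) (V : finType).

(* Points of TP^(n-1) are given by representatives in R^n, and subsets of     *)
(* TP^(n-1) by their (translation invariant) preimages in R^n.                *)
Definition tp_eq (x y : 'rV[R]_n) : Prop := exists c : R, x = y + const_mx c.

(* Primitivity in the lattice Z^n / Z(1,...,1); k = 0 excludes the zero class. *)
Definition tp_primitive (d : 'rV[int]_n) : Prop :=
  forall (k : nat) (f : 'rV[int]_n) (c : int),
    d = f *+ k + const_mx c -> k = 1%N.

Variable pos : V -> 'rV[R]_n.

Definition edge_dir (v : V) (w : vertex n V) : 'rV[R]_n :=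
  match w with
  | inl i => delta_mx 0 i
  | inr u => pos u - pos v
  end.

(* The half ray from pos v in direction e_i if w is the leaf i, and the       *)
(* segment from pos v to pos u if w is the internal vertex u.                 *)
Definition edge_points (v : V) (w : vertex n V) : set 'rV[R]_n :=
  [set x | exists t : R,
     [/\ 0 <= t, (if w is inr _ then t <= 1 else true)
       & tp_eq x (pos v + t *: edge_dir v w)]]%classic.

(* The geometric realization is injective: vertices are distinct, and two     *)
(* different closed edges meet only in a common vertex.                       *)
Definition embedded (E : lgraph n V) : Prop :=
  (forall u v, tp_eq (pos u) (pos v) -> u = v) /\
  (forall u w u' w', adj E (inr u) w -> adj E (inr u') w' ->
     [set inr u; w]%SET != [set inr u'; w']%SET ->
     forall x, edge_points u w x -> edge_points u' w' x ->
     exists v, [/\ inr v \in [set inr u; w]%SET,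
                   inr v \in [set inr u'; w']%SET & tp_eq x (pos v)]).

(* d v w is the primitive integer vector of the edge from v towards w. *)
Definition balanced (E : lgraph n V) : Prop :=
  exists d : V -> vertex n V -> 'rV[int]_n,
    (forall v w, adj E (inr v) w ->
       tp_primitive (d v w) /\
       exists2 r : R, 0 < r &
         tp_eq (edge_dir v w) (r *: map_mx intr (d v w))) /\
    (forall v, exists c : int,
       \sum_(w | adj E (inr v) w) d v w = const_mx c).

End TropicalLines.

(* L is a tropical line in TP^(n-1) whose underlying leaf-labeled tree is E. *)
Definition tropical_line (R : realType) (n : nat) (V : finType)
    (E : lgraph n V) (L : set 'rV[R]_n) : Prop :=
  labeled_tree E /\
  exists pos : V -> 'rV[R]_n,
    [/\ embedded pos E, balanced pos E
      & L = [set x | exists v w,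
               adj E (inr v) w /\ edge_points pos v w x]%classic].

Section Conics.
Variable R : realType.

Definition min_attained_twice (I : finType) (f : I -> R) : bool :=
  (1 < #|[set i | [forall j, (f i <= f j)%R]]%SET|)%N.

Definition trop_singular (k : nat) (A : 'M[R]_k) : bool :=
  min_attained_twice (fun s : {perm 'I_k} => \sum_i A i (s i)).

(* The monomials are ordered x^2, xy, y^2, yz, z^2, xz. *)
Definition veronese (p : 'rV[R]_3) : 'rV[R]_6 :=
  let x := p 0 0 in let y := p 0 1 in let z := p 0 2%:R in
  \row_(j < 6) [:: 2%:R * x; x + y; 2%:R * y; y + z; 2%:R * z; x + z]`_j.

Definition on_conic (a : 'rV[R]_6) (p : 'rV[R]_3) : bool :=
  min_attained_twice (fun j : 'I_6 => a 0 j + veronese p 0 j).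

Definition conic_matrix (P : 'I_4 -> 'rV[R]_3) : 'M[R]_(4, 6) :=
  \matrix_(i < 4) veronese (P i).

Definition generic (P : 'I_4 -> 'rV[R]_3) : Prop :=
  forall f : 'I_4 -> 'I_6, {homo f : i j / (i < j)%N} ->
    ~~ trop_singular (colsub f (conic_matrix P)).

Definition pencil (P : 'I_4 -> 'rV[R]_3) : set 'rV[R]_6 :=
  [set a | forall i, on_conic a (P i)]%classic.

Definition realizable (V : finType) (E : lgraph 6 V) : Prop :=
  exists P : 'I_4 -> 'rV[R]_3, generic P /\ tropical_line E (pencil P).

End Conics.

(* Main.v *)
(* The realizable trees are those all of whose splits are noncrossing for the *)
(* cyclic order x^2, xy, y^2, yz, z^2, xz of the boundary of the Newton       *)
(* triangle, i.e. the duals of the 14 triangulations of a hexagon.            *)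
(* Necessity: take a conic a in the interior of an edge of the pencil with    *)
(* direction e_A. Balancing makes A the set of leaves on one side of the      *)
(* edge, and for all but finitely many a the monomials attaining the minimum  *)
(* at P_m lie all in A or all outside A. If a set C cuts none of these four   *)
(* sets, then a + t e_C stays in the pencil for small t > 0, so e_C is        *)
(* parallel to e_A: the four sets connect A, and they connect its complement. *)
(* If A is crossing, some pair in one of them crosses some pair in another,   *)
(* which is impossible since both pairs are edges of the regular subdivision  *)
(* of the Newton triangle dual to a.                                          *)
(* Sufficiency: for each of the 14 trees an explicit configuration is given.  *)
(* All the polyhedra involved are cut out by bounds on differences of         *)
(* coordinates, so the pencil is computed by splitting into cells according   *)
(* to the pairs attaining the minima and propagating such bounds.             *)

From Stdlib Require Import ZArith.
From HB Require Import structures.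
From mathcomp Require Import all_boot all_order all_algebra all_fingroup.
From mathcomp Require Import boolp classical_sets reals.
From mathcomp Require Import ssrZ zify ring lra.
Require Import Defs.

Set Implicit Arguments.
Unset Strict Implicit.
Unset Printing Implicit Defensive.

(** * Classification of trivalent trees with six leaves *)

(** An internal edge of a tree splits the six leaves into a set A and its complement; let e_A be the
    sum of the e_i with i in A. A trivalent tree is realizable exactly when all its splits are
    noncrossing for the cyclic order of the labels. Such trees are dual to the triangulations of a
    hexagon: 14 in all, two of which have an inner triangle and give the snowflakes. The list
    [tree_codes] holds one code per isomorphism class ([trivalent6_tree_codes], [tree_codes_iso]),
    so [num_classes_tree_codes] reduces the counts to [realizable_code].

    Necessity ([realizable_noncrossing]): balancing, applied from the leaves inward, forces the
    direction e_A on the edge ([balanced_edge_dir]). Near an interior point of the edge the pencil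
    is one-dimensional ([embedded_local_dir]), so it can be deformed there only along e_A. Hence the
    sets of monomials minimal at the four points link all of A, and all of its complement. If the
    split were crossing, two of these sets would contain crossing chords, against
    [conic_min_crossing]; the argument is put together in [line_split_noncrossing].

    Sufficiency ([witness_realizable]): each noncrossing tree has a certificate made of four integer
    points and four vertex positions. The edges of the line and the cells of the pencil are both cut
    out by bounds on differences x_i - x_j, so that equality of line and pencil, and embeddedness,
    become finite computations with such bounds. *)

Section TreeIso.
Variables (n : nat) (V : finType).
Implicit Types E F : lgraph n V.

Lemma tree_isoP E F :
  reflect (exists s : {perm V},
             forall u w, adj E u w = adj F (relabel s u) (relabel s w))
          (tree_iso E F).
Proof.
apply: (iffP existsP) => -[s Es]; exists s.
  by move=> u w; apply/eqP; move: Es => /forallP/(_ u)/forallP/(_ w).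
by apply/forallP => u; apply/forallP => w; rewrite Es.
Qed.

Lemma relabelK (s : {perm V}) : cancel (@relabel n V s) (relabel s^-1).
Proof. by case=> //= v; rewrite permK. Qed.

Lemma relabelVK (s : {perm V}) : cancel (@relabel n V s^-1) (relabel s).
Proof. by case=> //= v; rewrite permKV. Qed.

Lemma tree_iso_refl : reflexive (@tree_iso n V).
Proof.
move=> E; apply/tree_isoP; exists 1%g => u w.
by case: u w => [i|u] [j|w] /=; rewrite ?perm1.
Qed.

Lemma tree_iso_sym : symmetric (@tree_iso n V).
Proof.
suff H E F : tree_iso E F -> tree_iso F E by move=> E F; apply/idP/idP; exact: H.
move=> /tree_isoP[s Es]; apply/tree_isoP; exists s^-1%g => u w.
by rewrite Es !relabelVK.
Qed.

Lemma tree_iso_trans : transitive (@tree_iso n V).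
Proof.
move=> F E G /tree_isoP[s Es] /tree_isoP[t Et]; apply/tree_isoP.
exists (s * t)%g => u w; rewrite Es Et.
by case: u w => [i|u] [j|w] /=; rewrite ?permM.
Qed.

(** Sending [c] to the class of [G c] is a bijection from [s] onto the classes. *)
Lemma num_classes_representatives (T : eqType) (s : seq T)
    (G : T -> lgraph n V) (Q : lgraph n V -> Prop) :
  uniq s -> (forall c, c \in s -> Q (G c)) ->
  (forall c d, c \in s -> d \in s -> tree_iso (G c) (G d) -> c = d) ->
  (forall E, Q E -> exists2 c, c \in s & tree_iso (G c) E) ->
  num_classes Q = size s.
Proof.
move=> s_uniq QG G_inj G_surj; rewrite /num_classes /equivalence_partition.
set D := [set E | _]%SET.
have D_Q E : E \in D = `[< Q E >] by rewrite inE.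
clearbody D; pose cls E := [set F in D | tree_iso E F]%SET.
have D_G c : c \in s -> G c \in D by move=> cs; rewrite D_Q; apply/asboolP/QG.
have clsP c d : c \in s -> d \in s -> cls (G c) = cls (G d) -> c = d.
  move=> cs ds /setP/(_ (G d)); rewrite !inE tree_iso_refl !D_G //= => iso_cd.
  exact: G_inj.
have -> : [set cls E | E in D]%SET = [set:: map (cls \o G) s].
  apply/setP => X; rewrite inE; apply/imsetP/mapP => [[E ED ->]|[c cs ->]].
    have [c cs isoE] : exists2 c, c \in s & tree_iso (G c) E.
      by apply: G_surj; apply/asboolP; rewrite -D_Q.
    exists c => //; apply/setP => F; rewrite !inE; congr (_ && _).
    by apply/idP/idP; apply: tree_iso_trans => //; rewrite tree_iso_sym.
  by exists (G c) => //; exact: D_G.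
rewrite cardsE (card_uniqP _) ?size_map // map_inj_in_uniq //.
Qed.

End TreeIso.

Definition ords4 : seq 'I_4 :=
  [:: @Ordinal 4 0 isT; @Ordinal 4 1 isT; @Ordinal 4 2 isT; @Ordinal 4 3 isT].

Definition ords6 : seq 'I_6 :=
  [:: @Ordinal 6 0 isT; @Ordinal 6 1 isT; @Ordinal 6 2 isT;
      @Ordinal 6 3 isT; @Ordinal 6 4 isT; @Ordinal 6 5 isT].

Lemma mem_ords4 v : v \in ords4.
Proof. by case: v => -[|[|[|[|]]]]. Qed.

Lemma mem_ords6 i : i \in ords6.
Proof. by case: i => -[|[|[|[|[|[|]]]]]]. Qed.

Lemma all_ords4P (P : pred 'I_4) : reflect (forall v, P v) (all P ords4).
Proof. by apply: (iffP allP) => PP v; rewrite ?PP ?mem_ords4. Qed.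

Lemma all_ords6P (P : pred 'I_6) : reflect (forall i, P i) (all P ords6).
Proof. by apply: (iffP allP) => PP v; rewrite ?PP ?mem_ords6. Qed.

Lemma perm_ords4 : perm_eq (index_enum 'I_4) ords4.
Proof.
by apply: uniq_perm; rewrite ?index_enum_uniq // => v; rewrite mem_ords4 mem_index_enum.
Qed.

Lemma perm_ords6 : perm_eq (index_enum 'I_6) ords6.
Proof.
by apply: uniq_perm; rewrite ?index_enum_uniq // => v; rewrite mem_ords6 mem_index_enum.
Qed.

(** * Trees as leaf attachments plus a graph on the internal vertices *)

Section TreeOfAttachment.
Implicit Types (f : 'I_6 -> 'I_4) (g : rel 'I_4).

Definition attach_adj f g : rel (vertex 6 'I_4) := fun u w =>
  match u, w with
  | inl i, inr v | inr v, inl i => f i == v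
  | inr a, inr b => g a b
  | inl _, inl _ => false
  end.

Definition attach_graph f g : lgraph 6 'I_4 :=
  [set p | attach_adj f g p.1 p.2]%SET.

Lemma adj_attach f g u w : adj (attach_graph f g) u w = attach_adj f g u w.
Proof. by rewrite /adj /= inE. Qed.

Lemma degree_attach_leaf f g i : degree (attach_graph f g) (inl i) = 1.
Proof.
apply/eqP/cards1P; exists (inr (f i)); apply/setP => -[j|v].
  by rewrite !inE /= adj_attach.
by rewrite !inE /= adj_attach /= eq_sym.
Qed.

Lemma degree_attach f g v :
  degree (attach_graph f g) (inr v) =
  (count (fun i => f i == v) ords6 + count (g v) ords4)%N.
Proof.
rewrite /degree -sum1_card big_mkcond big_sumType; congr addn.
  rewrite -sum1_count [RHS]big_mkcond (perm_big _ perm_ords6).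
  by apply: eq_bigr => i _; rewrite inE adj_attach.
rewrite -sum1_count [RHS]big_mkcond (perm_big _ perm_ords4).
by apply: eq_bigr => i _; rewrite inE adj_attach.
Qed.

Lemma iso_attach f g (s : {perm 'I_4}) g' :
  (forall a b, g a b = g' (s a) (s b)) ->
  tree_iso (attach_graph f g) (attach_graph (s \o f) g').
Proof.
move=> gg'; apply/tree_isoP; exists s => u w; rewrite !adj_attach.
by case: u w => [i|u] [j|w] //=; rewrite (inj_eq perm_inj).
Qed.

Lemma eq_attach f f' g g' : f =1 f' -> g =2 g' ->
  attach_graph f g = attach_graph f' g'.
Proof.
move=> ff' gg'; apply/setP => -[u w].
by case: u w => [i|u] [j|w]; rewrite !inE //= ?ff' ?gg'.
Qed.

(** An edge between two leaves would be a whole connected component, so every leaf hangs on an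
    internal vertex. Absence of triangles, combined with the edge count, makes the internal graph a
    tree in [shape_of_rel]. *)
Lemma trivalent6_attach E : trivalent6 E ->
  exists f g, [/\ E = attach_graph f g, symmetric g, irreflexive g
    & forall a b c, g a b -> g b c -> g c a -> False].
Proof.
move=> [[[Esym Eirr Econn Eacyc] leaf1] inner3].
have leafN i j : ~~ adj E (inl i) (inl j).
  apply/negP => Eij.
  have uniq_nbr k x y : adj E (inl k) x -> adj E (inl k) y -> x = y.
    move=> kx ky; move: (leaf1 k) => /eqP/cards1P[z /setP nbr].
    by move: (nbr x) (nbr y); rewrite !inE kx ky => /esym/eqP-> /esym/eqP->.
  have cl : closed (adj E) [set inl i; inl j]%SET.
    move=> x y xy; rewrite !inE; apply/idP/idP => /orP[] /eqP ex.
    - by move: xy; rewrite ex => iy; rewrite (uniq_nbr _ _ _ iy Eij) eqxx orbT.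
    - by move: xy; rewrite ex => jy; rewrite Esym in Eij;
        rewrite (uniq_nbr _ _ _ jy Eij) eqxx.
    - by move: xy; rewrite ex Esym => iy; rewrite (uniq_nbr _ _ _ iy Eij) eqxx orbT.
    - by move: xy; rewrite ex Esym => jy; rewrite Esym in Eij;
        rewrite (uniq_nbr _ _ _ jy Eij) eqxx.
  have := closed_connect cl (Econn (inl i) (inr ord0)).
  by rewrite !inE eqxx.
have /choice[f fP] i : exists v, forall w, adj E (inl i) (inr w) = (v == w).
  move: (leaf1 i) => /eqP/cards1P[[j|v] /setP nbr].
    by have := nbr (inl j); rewrite !inE eqxx (negbTE (leafN _ _)).
  by exists v => w; have := nbr (inr w); rewrite !inE eq_sym.
exists f, (fun a b => adj E (inr a) (inr b)); split.
- apply/setP => -[u w]; rewrite [in RHS]inE /=.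
  case: u w => [i|u] [j|w] /=.
  + by apply/negbTE/leafN.
  + by rewrite -fP.
  + by rewrite -fP Esym.
  + by [].
- by move=> a b; rewrite Esym.
- by move=> a; rewrite Eirr.
- move=> a b c ab bc ca.
  have := Eacyc [:: inr a; inr b; inr c]; rewrite /ucycle /= ab bc ca.
  have neq x y : adj E (inr x) (inr y) -> (inr x == inr y :> vertex 6 'I_4) = false.
    by move=> xy; apply/eqP => exy; rewrite exy Eirr in xy.
  rewrite !inE (neq _ _ ab) (neq _ _ bc) eq_sym (neq _ _ ca).
  by move=> /(_ isT).
Qed.

End TreeOfAttachment.

Section AcyclicByDepth.
Variables (T : finType) (e : rel T) (depth : T -> nat).

(* At an element of maximal depth, both cycle neighbours would be its parent. *)
Lemma acyclic_depth :
  symmetric e ->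
  (forall x y, e x y -> depth x != depth y) ->
  (forall x y z, e x y -> e x z -> depth y < depth x -> depth z < depth x ->
     y = z)%N ->
  forall c : seq T, ucycle e c -> (size c <= 2)%N.
Proof.
move=> esym depthN parent c /andP[cyc uniq_c].
case: c cyc uniq_c => // x0 c cyc uniq_c.
have [x xc xmax] := @arg_maxnP T x0 (mem (x0 :: c)) depth (mem_head _ _).
have xc' : x \in x0 :: c by [].
have [i s def_s] := rot_to xc'.
have : path.cycle e (x :: s) by rewrite -def_s rot_cycle.
have : uniq (x :: s) by rewrite -def_s rot_uniq.
have {}xmax y : y \in s -> (depth y <= depth x)%N.
  move=> ys; apply: xmax; have : y \in x :: s by rewrite inE ys orbT.
  by rewrite -def_s mem_rot.
rewrite -(size_rot i) def_s.
case: s xmax {def_s} => [|y s] xmax //=; case/lastP: s xmax => [|s z] xmax //.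
rewrite rcons_path => /and3P[_ ys _] /and3P[xy _]; rewrite last_rcons => zx.
have ltx t : e x t -> t \in y :: rcons s z -> (depth t < depth x)%N.
  by move=> xt tc; rewrite ltn_neqAle xmax // eq_sym depthN.
suff yz : y = z by rewrite yz mem_rcons mem_head in ys.
have zc : z \in y :: rcons s z by rewrite inE mem_rcons mem_head orbT.
by apply: (parent x); rewrite ?ltx ?mem_head // esym.
Qed.

End AcyclicByDepth.

(* The internal vertices form the path 0-1-2-3 or the star with center 0. *)
Definition shape (star : bool) : rel 'I_4 := fun a b =>
  if star then (a != b) && ((a == ord0) || (b == ord0))
  else (a.+1 == b :> nat) || (b.+1 == a :> nat).

Lemma shape_sym star : symmetric (shape star).
Proof.
by case: star => a b; rewrite /shape /= orbC // eq_sym.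
Qed.

Lemma shape_irr star : irreflexive (shape star).
Proof.
by case: star => a; rewrite /shape /= ?eqxx // orbb; apply/negbTE; lia.
Qed.

(* A code (star, w) describes the tree whose internal vertices form           *)
(* shape star and whose leaf i hangs on the internal vertex attach w i.       *)
Definition attach (w : seq 'I_4) (i : 'I_6) : 'I_4 := nth ord0 w i.

Definition code_graph (c : bool * seq 'I_4) : lgraph 6 'I_4 :=
  attach_graph (attach c.2) (shape c.1).

(** An internal vertex with k internal neighbours carries 3 - k leaves; this fixes the multiset of
    attachments. *)
Definition leaf_word (star : bool) : seq 'I_4 :=
  let o k := nth ord0 ords4 k in
  if star then [:: o 1; o 1; o 2; o 2; o 3; o 3]
  else [:: o 0; o 0; o 1; o 2; o 3; o 3].

Definition cubic (c : bool * seq 'I_4) : bool := perm_eq c.2 (leaf_word c.1).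

Lemma map_attach w : size w = 6 -> map (attach w) ords6 = w.
Proof. by case: w => [|? [|? [|? [|? [|? [|? []]]]]]]. Qed.

Lemma count_leaf_word star v :
  count_mem v (leaf_word star) + count (shape star v) ords4 = 3.
Proof.
by move: (mem_ords4 v); rewrite !inE; case: star; do 4?[case/orP] => /eqP->.
Qed.

Lemma cubicP star w : size w = 6 ->
  reflect (forall v, count (fun i => attach w i == v) ords6
                     + count (shape star v) ords4 = 3)
          (cubic (star, w)).
Proof.
move=> sz_w; have cnt v : count (fun i => attach w i == v) ords6 = count_mem v w.
  by rewrite -[in RHS](map_attach sz_w) count_map.
rewrite /cubic; apply: (iffP idP) => [/seq.permP w_leaf v | deg3].
  by rewrite cnt w_leaf count_leaf_word.
apply/allP => v _ /=; rewrite -(eqn_add2r (count (shape star v) ords4)).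
by rewrite count_leaf_word -cnt deg3.
Qed.

Lemma cubic_size star w : cubic (star, w) -> size w = 6.
Proof. by move=> /perm_size ->; case: star. Qed.

(* The automorphisms of the path and of the star are used up by naming 0 the  *)
(* end that is met first, and by fixing the order in which the arms of the    *)
(* star are met last, which is the order of undup.                            *)
Definition normalized (c : bool * seq 'I_4) : bool :=
  if c.1 then [seq nat_of_ord v | v <- undup c.2] == [:: 1; 2; 3]
  else head 0 [seq nat_of_ord v | v : 'I_4 <- c.2 & (v == 0 :> nat) || (v == 3 :> nat)]
       == 0.

Definition cubic_codes (star : bool) : seq (bool * seq 'I_4) :=
  [seq (star, w) | w <- permutations (leaf_word star)].

Definition tree_codes : seq (bool * seq 'I_4) :=
  [seq c <- cubic_codes false ++ cubic_codes true | normalized c].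

Lemma mem_cubic_codes star c :
  (c \in cubic_codes star) = (c.1 == star) && cubic c.
Proof.
case: c => b w; apply/mapP/andP => /= [[w' w'_in [-> ->]]|[/eqP-> cub]].
  by split=> //; rewrite /cubic -mem_permutations.
by exists w; rewrite // mem_permutations.
Qed.

Lemma mem_tree_codes c : (c \in tree_codes) = normalized c && cubic c.
Proof.
by rewrite mem_filter mem_cat !mem_cubic_codes -andb_orl; case: c => -[] w.
Qed.

Lemma size_tree_codes : size tree_codes = 105.
Proof. by vm_compute. Qed.

(** The distance from the root 0, as needed for [acyclic_depth]. *)
Definition shape_depth (star : bool) (v : 'I_4) : nat :=
  if star then (v != ord0 : nat) else v.

Lemma trivalent6_code c : cubic c -> trivalent6 (code_graph c).
Proof.
case: c => star w cub; have /(cubicP _ (cubic_size cub)) deg3 := cub.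
pose depth (u : vertex 6 'I_4) : nat := match u with
  | inl i => (shape_depth star (attach w i)).+1
  | inr v => shape_depth star v end.
split=> [|v]; last first.
  by rewrite degree_attach; exact: deg3.
split=> [|i]; last exact: degree_attach_leaf.
have Esym : symmetric (adj (code_graph (star, w))).
  move=> u v; rewrite !adj_attach.
  by case: u v => [i|u] [j|v] //=; exact: shape_sym.
split=> //.
- by move=> [i|v]; rewrite adj_attach //= shape_irr.
- suff H u : connect (adj (code_graph (star, w))) u (inr ord0).
    move=> u v; apply: connect_trans (H u) _.
    by rewrite (sym_connect_sym Esym).
  have Hv v : connect (adj (code_graph (star, w))) (inr v) (inr ord0).
    have [->|v0] := eqVneq v ord0; first exact: connect0.
    case: star depth Esym {cub deg3} => depth Esym.
      by apply: connect1; rewrite adj_attach /= /shape /= v0 eqxx orbT.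
    case: v v0 => k; elim: k => [|k IH] k4 v0; first by rewrite -val_eqE in v0.
    apply: (@connect_trans _ _ (inr (Ordinal (ltnW k4)))).
      by apply: connect1; rewrite adj_attach /= /shape /= eqxx orbT.
    have [k0|k0] := eqVneq (Ordinal (ltnW k4)) ord0.
      by rewrite k0; exact: connect0.
    exact: IH.
  case: u => [i|v] //; apply: connect_trans (Hv (attach w i)).
  by apply: connect1; rewrite adj_attach /=.
- apply: (@acyclic_depth _ _ depth) => //.
  + move=> [i|u] [j|v]; rewrite adj_attach //=.
    * by move/eqP=> <-; rewrite neq_ltn ltnSn orbT.
    * by move/eqP=> <-; rewrite neq_ltn ltnSn.
    * rewrite /shape /shape_depth.
      by case: (star) => /=; rewrite -?val_eqE /=; lia.
  + move=> [i|u] [j|v] [k|t]; rewrite !adj_attach //=.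
    * by move=> /eqP<- /eqP<-.
    * by move=> /eqP<- _ /ltnW; rewrite ltnn.
    * by move=> /eqP<- _ /ltnW; rewrite ltnn.
    * by move=> _ /eqP<- _ /ltnW; rewrite ltnn.
    * move=> ut uv H1 H2; congr inr; apply: val_inj; move: ut uv H1 H2.
      rewrite /shape /shape_depth.
      by case: (star) => /=; rewrite -?val_eqE /=; lia.
Qed.

(** * Every trivalent tree has exactly one normalized code *)

Definition apply_word (p : seq 'I_4) (v : 'I_4) : 'I_4 := nth ord0 p v.

Definition relabelings : seq (seq 'I_4) := permutations ords4.

Lemma relabeling_perm p : p \in relabelings ->
  exists s : {perm 'I_4}, s =1 apply_word p.
Proof.
move=> p_rel.
have inj_p : injective (apply_word p).
  have : all (fun p => all (fun a => all (fun b =>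
      (apply_word p a == apply_word p b) ==> (a == b)) ords4) ords4) relabelings.
    by vm_compute.
  move=> /allP/(_ p p_rel)/all_ords4P H a b /eqP eab.
  by move: (H a) => /all_ords4P/(_ b); rewrite eab => /eqP.
by exists (perm inj_p) => v; rewrite permE.
Qed.

Definition automorphisms (star : bool) : seq (seq 'I_4) :=
  [seq p <- relabelings | all (fun a => all (fun b =>
     shape star (apply_word p a) (apply_word p b) == shape star a b)
     ords4) ords4].

(** Automorphisms of the shape act on the cubic codes, and a finite check finds a normalized code in
    every orbit. *)
Lemma normalize_code c : cubic c ->
  exists2 d, d \in tree_codes & tree_iso (code_graph d) (code_graph c).
Proof.
case: c => star w cub; have sz_w := cubic_size cub.
have : all (fun star => let auts := automorphisms star in
    all (fun c => has (fun p => let d := (c.1, map (apply_word p) c.2) in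
             normalized d && cubic d) auts) (cubic_codes star))
    [:: false; true] by vm_compute.
have star_in : star \in [:: false; true] by case: (star).
have c_in : (star, w) \in cubic_codes star by rewrite mem_cubic_codes eqxx.
move=> /allP/(_ star star_in)/allP/(_ _ c_in)/hasP[p].
rewrite mem_filter => /andP[/all_ords4P autp /relabeling_perm[s sp]] /= good.
exists (star, map (apply_word p) w); first by rewrite mem_tree_codes.
rewrite tree_iso_sym /code_graph /=.
have -> : attach_graph (attach (map (apply_word p) w)) (shape star)
          = attach_graph (s \o attach w) (shape star).
  by apply: eq_attach => // i; rewrite /= sp /attach (nth_map ord0) // sz_w.
apply: iso_attach => a b; rewrite !sp.
by move: (autp a) => /all_ords4P/(_ b)/eqP.
Qed.

Fixpoint bit_words (k : nat) : seq (seq bool) :=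
  if k is k'.+1 then [seq b :: e | b <- [:: false; true], e <- bit_words k']
  else [:: [::]].

Lemma mem_bit_words e : e \in bit_words (size e).
Proof.
elim: e => [|b e IH] //; apply: (allpairs_f _ _ IH); by case: b.
Qed.

(* The bits of e are the edges 01, 02, 03, 12, 13, 23. *)
Definition bits_rel (e : seq bool) : rel 'I_4 := fun a b =>
  if a < b then nth false e ((a + b).-1 + (0 < a))
  else if b < a then nth false e ((a + b).-1 + (0 < b)) else false.

Definition rel_bits (g : rel 'I_4) : seq bool :=
  [seq g p.1 p.2 | p <- [seq p : 'I_4 * 'I_4 <- [seq (a, b) | a <- ords4, b <- ords4]
                           | p.1 < p.2]].

Lemma rel_bitsK g : symmetric g -> irreflexive g -> bits_rel (rel_bits g) =2 g.
Proof.
move=> gsym girr a b; move: (mem_ords4 a) (mem_ords4 b); rewrite !inE.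
by do 4?[case/orP] => /eqP->; do 4?[case/orP] => /eqP->;
  rewrite /bits_rel /= ?girr // gsym.
Qed.

Definition forest_rel (r : rel 'I_4) : bool :=
  all (fun a => all (fun b => all (fun c =>
    ~~ [&& r a b, r b c & r c a]) ords4) ords4) ords4
  && (sumn [seq count (r v) ords4 | v <- ords4] == 6).

Definition shaped_rel (r : rel 'I_4) : bool :=
  has (fun star => has (fun p => all (fun a => all (fun b =>
    r a b == shape star (apply_word p a) (apply_word p b)) ords4) ords4)
    relabelings) [:: false; true].

(** A triangle-free graph with three edges on four vertices is a tree, hence the path or the star;
    this is decided over all 64 graphs. *)
Lemma shape_of_rel (g : rel 'I_4) : symmetric g -> irreflexive g ->
  (forall a b c, g a b -> g b c -> g c a -> False) ->
  sumn [seq count (g v) ords4 | v <- ords4] = 6 ->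
  exists star (s : {perm 'I_4}), forall a b, g a b = shape star (s a) (s b).
Proof.
move=> gsym girr gtri gsum.
have : all (fun e => if forest_rel (bits_rel e) then shaped_rel (bits_rel e)
                     else true) (bit_words 6) by vm_compute.
have gK := rel_bitsK gsym girr.
move=> /allP/(_ (rel_bits g) (mem_bit_words (rel_bits g))).
have -> : forest_rel (bits_rel (rel_bits g)).
  apply/andP; split.
    do 3![apply/all_ords4P => ?]; rewrite !gK.
    by apply/and3P => -[]; exact: gtri.
  rewrite -gsum; apply/eqP; congr sumn.
  by apply: eq_map => v; apply: eq_count => u; rewrite gK.
move=> /hasP[star _ /hasP[p /relabeling_perm[s sp] rp]].
exists star, s => a b; rewrite -gK !sp; apply/eqP.
by move: rp => /all_ords4P/(_ a)/all_ords4P/(_ b).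
Qed.

Lemma sumn_map_add (T : Type) (F G : T -> nat) (k : nat) (l : seq T) :
  (forall x, F x + G x = k) ->
  sumn [seq F x | x <- l] + sumn [seq G x | x <- l] = k * size l.
Proof. by move=> FG; elim: l => [|x l IH] /=; rewrite ?muln0 //; have := FG x; lia. Qed.

Lemma trivalent6_tree_codes E : trivalent6 E ->
  exists2 c, c \in tree_codes & tree_iso (code_graph c) E.
Proof.
move=> E3; have [_ deg3] := E3.
have [f [g [def_E gsym girr gtri]]] := trivalent6_attach E3.
have {}deg3 v : count (fun i => f i == v) ords6 + count (g v) ords4 = 3.
  by rewrite -degree_attach -def_E.
(* Four vertices of degree 3 have 12 edge ends, six of which go to leaves. *)
have gsum : sumn [seq count (g v) ords4 | v <- ords4] = 6.
  have fsum l : sumn [seq count (fun i => f i == v) l | v <- ords4] = size l.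
    elim: l => //= i l <-.
    suff : (f i == nth ord0 ords4 0) + (f i == nth ord0 ords4 1)
      + (f i == nth ord0 ords4 2) + (f i == nth ord0 ords4 3) = 1 by move=> /=; lia.
    by move: (mem_ords4 (f i)); rewrite !inE; do 4?[case/orP] => /eqP->.
  by move: (sumn_map_add ords4 deg3); rewrite fsum [size ords4]/= [size ords6]/=; lia.
have [star [s gs]] := shape_of_rel gsym girr gtri gsum.
pose w := [seq s (f i) | i <- ords6].
have wE : attach w =1 s \o f.
  by move=> i; move: (mem_ords6 i); rewrite !inE; do 6?[case/orP] => /eqP->.
have iso_w : tree_iso E (code_graph (star, w)).
  rewrite def_E /code_graph /=.
  have -> : attach_graph (attach w) (shape star)
            = attach_graph (s \o f) (shape star) by exact: eq_attach.
  exact: iso_attach.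
have cub : cubic (star, w).
  apply/cubicP; first by rewrite size_map.
  move=> v; rewrite -(permKV s v).
  apply: etrans (deg3 (s^-1%g v)); congr addn.
    by apply: eq_count => i; rewrite wE /= (inj_eq perm_inj).
  rewrite -!sum1_count -!(perm_big _ perm_ords4) (reindex_inj (@perm_inj _ s)).
  by apply: eq_bigl => u; rewrite gs.
have [d d_code iso_d] := normalize_code cub.
exists d => //; apply: tree_iso_trans iso_d _; by rewrite tree_iso_sym.
Qed.

(** Isomorphisms fix the leaves, so it is invariant which leaves share a vertex and which hang on
    adjacent vertices. This data already separates the 105 codes. *)
Definition signature (c : bool * seq 'I_4) : seq (bool * bool) :=
  [seq (attach c.2 i == attach c.2 j, shape c.1 (attach c.2 i) (attach c.2 j))
     | i <- ords6, j <- ords6].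

Lemma iso_signature c d : tree_iso (code_graph c) (code_graph d) ->
  signature c = signature d.
Proof.
move=> /tree_isoP[s cd].
have fE i : attach d.2 i = s (attach c.2 i).
  have := cd (inl i) (inr (attach c.2 i)); rewrite !adj_attach /= eqxx.
  by move=> /esym/eqP.
apply: eq_allpairs => i j; rewrite !fE (inj_eq perm_inj); congr pair.
by have := cd (inr (attach c.2 i)) (inr (attach c.2 j)); rewrite !adj_attach.
Qed.

Lemma uniq_signatures : uniq (map signature tree_codes).
Proof. by vm_compute. Qed.

Lemma tree_codes_iso c d : c \in tree_codes -> d \in tree_codes ->
  tree_iso (code_graph c) (code_graph d) -> c = d.
Proof.
move=> c_in d_in /iso_signature; rewrite -{1}(nth_index c c_in).
rewrite -{1}(nth_index c d_in) -!(nth_map _ [::]) ?index_mem // => /eqP.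
rewrite nth_uniq ?uniq_signatures ?size_map ?index_mem // => /eqP eq_cd.
by rewrite -(nth_index c c_in) eq_cd nth_index.
Qed.

Lemma num_classes_tree_codes (Q : lgraph 6 'I_4 -> Prop)
    (P : pred (bool * seq 'I_4)) :
  (forall E, Q E -> trivalent6 E) ->
  (forall c, c \in tree_codes -> P c -> Q (code_graph c)) ->
  (forall c E, c \in tree_codes -> tree_iso (code_graph c) E -> Q E -> P c) ->
  num_classes Q = count P tree_codes.
Proof.
move=> Q_tri PQ QP; rewrite -size_filter.
apply: (num_classes_representatives (G := code_graph)).
- by rewrite filter_uniq // (map_uniq uniq_signatures).
- by move=> c; rewrite mem_filter => /andP[Pc c_in]; exact: PQ.
- move=> c d; rewrite mem_filter => /andP[_ c_in].
  by rewrite mem_filter => /andP[_ d_in]; exact: tree_codes_iso.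
- move=> E QE; have [c c_in iso_c] := trivalent6_tree_codes (Q_tri _ QE).
  by exists c => //; rewrite mem_filter c_in andbT; exact: QP QE.
Qed.

(** * Edges of a tropical line and their splits *)

Section Geometry.
Import Order.TTheory GRing.Theory Num.Theory.
Local Open Scope ring_scope.

Section TropicalPoints.
Variables (R : realType) (n : nat).
Implicit Types x y z : 'rV[R]_n.

Lemma tp_eqP x y : tp_eq x y <-> forall i j, x 0 i - x 0 j = y 0 i - y 0 j.
Proof.
split=> [[c ->] i j | xy]; first by rewrite !mxE; ring.
case: n x y xy => [|m] x y xy.
  by exists 0; apply/rowP => -[].
by exists (x 0 ord0 - y 0 ord0); apply/rowP => i; rewrite !mxE; have := xy i ord0; lra.
Qed.

Definition indic (A : {set 'I_n}) : 'rV[R]_n := \row_j (j \in A)%:R.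

(** The integer k = d_a - d_b satisfies r k = 1, so d is k e_A modulo (1,...,1), and primitivity
    gives k = 1. *)
Lemma primitive_indic (d : 'rV[int]_n) (A : {set 'I_n}) (r : R) a b :
  tp_primitive d -> 0 < r -> a \in A -> b \notin A ->
  tp_eq (r *: map_mx intr d) (indic A) -> tp_eq (map_mx intr d) (indic A).
Proof.
move=> d_prim r_gt0 aA bA /tp_eqP rd.
have rdE i j : r * (d 0 i - d 0 j)%:~R = (i \in A)%:R - (j \in A)%:R.
  by have := rd i j; rewrite !mxE -mulrBr intrB.
have rk : r * (d 0 a - d 0 b)%:~R = 1 by rewrite rdE aA (negbTE bA) subr0.
set k := d 0 a - d 0 b in rk.
have k_gt0 : 0 < k by rewrite -(ltr0z R) -(pmulr_rgt0 _ r_gt0) rk ltr01.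
have dE i j : d 0 i - d 0 j = k * ((i \in A)%:R - (j \in A)%:R).
  apply: (@intr_inj R); apply: (mulfI (lt0r_neq0 r_gt0)).
  by rewrite rdE intrM mulrA rk mul1r intrB !natz.
have k1 : `|k|%N = 1%N.
  apply: (d_prim _ (\row_i (i \in A)%:R) (d 0 b)); apply/rowP => i.
  have := dE i b; rewrite (negbTE bA) subr0 => /eqP; rewrite subr_eq => /eqP ->.
  rewrite mxE mulmxnE !mxE; congr (_ + _).
  by case: (i \in A); rewrite ?mulr0 ?mul0rn // mulr1 -[RHS]/(`|k|%:R) natz gtz0_abs.
have {}k1 : k = 1 by rewrite -(gtz0_abs k_gt0) k1.
apply/tp_eqP => i j; rewrite !mxE -intrB dE k1 mul1r intrB.
by case: (i \in A); case: (j \in A).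
Qed.

End TropicalPoints.

Section EdgeDirections.
Variables (R : realType) (n : nat) (V : finType) (E : lgraph n V).
Variables (pos : V -> 'rV[R]_n) (side : V -> vertex n V -> {set 'I_n}).
Variable (rank : V -> V -> nat).

Hypothesis Esym : symmetric (adj E).
Hypothesis side_leaf : forall v i, side v (inl i) = [set i]%SET.
Hypothesis side_proper : forall v w, adj E (inr v) w ->
  exists a b, a \in side v w /\ b \notin side v w.
Hypothesis side_rec : forall v w i, adj E (inr v) (inr w) ->
  nat_of_bool (i \in side v (inr w)) =
  (\sum_(x | adj E (inr w) x && (x != inr v)) (i \in side w x))%N.
Hypothesis rank_lt : forall v w x, adj E (inr v) (inr w) ->
  adj E (inr w) (inr x) -> x != v -> (rank w x < rank v w)%N.

(** Induction on [rank], from the leaves inward: at [w] the primitive vectors of the edges other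
    than [wv] are indicators of disjoint sides with union the side of [vw], so balancing determines
    the vector of [wv]. *)
Lemma balanced_edge_dir : balanced pos E ->
  forall v w, adj E (inr v) w ->
  exists2 r : R, 0 < r & tp_eq (edge_dir pos v w) (r *: indic R (side v w)).
Proof.
move=> [d [d_prim d_sum]].
suff dE : forall v w, adj E (inr v) w ->
    tp_eq (map_mx intr (d v w)) (indic R (side v w)).
  move=> v w vw; have [_ [r r_gt0 /tp_eqP rE]] := d_prim v w vw.
  exists r => //; apply/tp_eqP => i j; rewrite rE.
  by have /tp_eqP/(_ i j) := dE v w vw; rewrite !mxE -!mulrBr => ->.
have reduce v w r : adj E (inr v) w -> 0 < r ->
    tp_eq (edge_dir pos v w) (r *: indic R (side v w)) ->
    tp_eq (map_mx intr (d v w)) (indic R (side v w)).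
  move=> vw r_gt0 /tp_eqP dirE; have [a [b [aS bS]]] := side_proper vw.
  have [prim [q q_gt0 /tp_eqP qE]] := d_prim v w vw.
  apply: (primitive_indic prim (divr_gt0 q_gt0 r_gt0) aS bS).
  apply/tp_eqP => i j; have := dirE i j; rewrite qE !mxE => e.
  by apply: (mulfI (lt0r_neq0 r_gt0)); rewrite [RHS]mulrBr -e; field; rewrite lt0r_neq0.
move=> v [i|w] vw.
  apply: (reduce _ _ 1 vw ltr01); rewrite side_leaf; apply/tp_eqP => a b.
  by rewrite !mxE /= mul1r mul1r !inE.
have [m] := ubnP (rank v w); elim: m v w vw => // m IH v w vw rank_m.
have wv : adj E (inr w) (inr v) by rewrite Esym.
(* Seen from [w] the segment has the opposite direction, which gives access to the balancing at
   [w]. *)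
have [_ [q q_gt0 /tp_eqP qE]] := d_prim w (inr v) wv.
have others x i j : adj E (inr w) x && (x != inr v) ->
    (d w x 0 i)%:~R - (d w x 0 j)%:~R = (i \in side w x)%:R - (j \in side w x)%:R :> R.
  move=> /andP[wx xv]; suff /tp_eqP/(_ i j) :
    tp_eq (map_mx intr (d w x)) (indic R (side w x)) by rewrite !mxE.
  case: x wx xv => [k|x] wx xv.
    apply: (reduce _ _ 1 wx ltr01); rewrite side_leaf; apply/tp_eqP => a b.
    by rewrite !mxE /= mul1r mul1r !inE.
  by apply: IH => //; apply: leq_trans (rank_lt vw wx xv) _; rewrite -ltnS.
apply: (reduce _ _ q vw q_gt0); apply/tp_eqP => i j.
have [c /rowP sumE] := d_sum w.
have sum0 : \sum_(x | adj E (inr w) x) ((d w x 0 i)%:~R - (d w x 0 j)%:~R) = 0 :> R.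
  have cE k : \sum_(x | adj E (inr w) x) (d w x 0 k)%:~R = c%:~R :> R.
    by rewrite -rmorph_sum /= -summxE sumE mxE.
  by rewrite sumrB !cE subrr.
move: sum0; rewrite (bigD1 (inr v)) //= (eq_bigr _ (fun x => @others x i j)) sumrB.
rewrite -!natr_sum -!side_rec // => sum0.
have := qE i j; rewrite !mxE /= -!mulrBr.
move: sum0 => /eqP; rewrite addr_eq0 => /eqP ->.
by rewrite mulrN => e; rewrite -[RHS]opprK -e; ring.
Qed.

End EdgeDirections.

Section LocalStructure.
Variable R : realType.

Lemma near0_all (I : finType) (P : I -> R -> Prop) :
  (forall i, exists2 e, 0 < e & forall t, 0 < t -> t < e -> P i t) ->
  exists2 e, 0 < e & forall i t, 0 < t -> t < e -> P i t.
Proof.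
move=> nearP; suff [e e_gt0 eP] : exists2 e, 0 < e &
    forall i, i \in enum I -> forall t, 0 < t -> t < e -> P i t.
  by exists e => // i; apply: eP; rewrite mem_enum.
elim: (enum I) => [|i s [e e_gt0 eP]]; first by exists 1.
have [e' e'_gt0 e'P] := nearP i; exists (Num.min e e').
  by rewrite lt_min e_gt0.
move=> j; rewrite inE => /orP[/eqP->|js] t t_gt0; rewrite lt_min => /andP[te te'].
  exact: e'P.
exact: (eP j).
Qed.

Lemma avoid_finite (s : seq R) (l u : R) : l < u ->
  exists t, [/\ l < t, t < u & t \notin s].
Proof.
elim: s l u => [|x s IH] l u lu.
  by exists ((l + u) / 2); split=> //; lra.
have [xl|lx] := lerP x l.
  have [t [lt tu ts]] := IH _ _ lu; exists t; split=> //.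
  by rewrite inE negb_or ts andbT; apply/eqP; lra.
have l_min : l < Num.min x u by rewrite lt_min lx.
have [t [lt]] := IH _ _ l_min; rewrite lt_min => /andP[tx tu] ts.
exists t; split=> //; rewrite inE negb_or ts andbT; apply/eqP; lra.
Qed.

Section Embedded.
Variables (n : nat) (V : finType) (E : lgraph n V) (pos : V -> 'rV[R]_n).
Let L x := exists v w, adj E (inr v) w /\ edge_points pos v w x.

(** Two points of the ray on the edge make [u] a multiple of its direction; unless [u] vanishes, [x]
    is on the edge because the edge is closed. *)
Lemma edge_accumulation (v : V) (w : vertex n V) (x u : 'rV[R]_n) :
  (forall e, 0 < e -> exists t, [/\ 0 < t, t < e & edge_points pos v w (x + t *: u)]) ->
  exists k, tp_eq u (k *: edge_dir pos v w) /\
    (k = 0 \/ edge_points pos v w x).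
Proof.
set D := edge_dir pos v w => acc.
have [t1 [t1_gt0 _ [s1 [s1_ge0 s1_le1 /tp_eqP e1]]]] := acc 1 ltr01.
have [t2 [t2_gt0 t21 [s2 [s2_ge0 s2_le1 /tp_eqP e2]]]] := acc t1 t1_gt0.
have t12 : t1 - t2 != 0 by rewrite subr_eq0 gt_eqF.
pose k := (s1 - s2) / (t1 - t2).
have uE i j : u 0 i - u 0 j = k * (D 0 i - D 0 j).
  move: (e1 i j) (e2 i j); rewrite !mxE -/D => a b.
  have kE : (t1 - t2) * k = s1 - s2 by rewrite mulrC divfK.
  by apply: (mulfI t12); rewrite mulrA kE; lra.
have [D0|] := pselect (forall i j, D 0 i - D 0 j = 0).
  by exists 0; split; [apply/tp_eqP => i j; rewrite uE D0 !mxE; lra | left].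
move=> /existsNP[i0 /existsNP[j0 D0]].
exists k; split; first by apply/tp_eqP => i j; rewrite uE !mxE; ring.
right; pose s0 := s1 - t1 * k.
have xE i j : x 0 i - x 0 j = pos v 0 i - pos v 0 j + s0 * (D 0 i - D 0 j).
  move: (e1 i j) (uE i j); rewrite !mxE -/D /s0 => a b.
  by rewrite mulrBl -mulrA -b; lra.
have sE t s : tp_eq (x + t *: u) (pos v + s *: D) -> s = s0 + t * k.
  move=> /tp_eqP/(_ i0 j0); rewrite !mxE => e.
  have {}e : (s - (s0 + t * k)) * (D 0 i0 - D 0 j0) = 0.
    move: (xE i0 j0) (uE i0 j0) => a b; rewrite mulrBl mulrDl -mulrA -b; lra.
  by move/eqP: e; rewrite mulf_eq0 => /orP[/eqP|/eqP //]; lra.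
have small e : 0 < e -> exists t, [/\ 0 < t, `|t * k| < e & edge_points pos v w (x + t *: u)].
  move=> e_gt0; have k1_gt0 : 0 < `|k| + 1 by rewrite ltr_wpDl.
  have [t [t_gt0 te xt]] := acc _ (divr_gt0 e_gt0 k1_gt0); exists t; split=> //.
  rewrite normrM (gtr0_norm t_gt0); rewrite ltr_pdivlMr // in te.
  by apply: le_lt_trans te; rewrite ler_pM2l // lerDl.
exists s0; split; last by apply/tp_eqP => i j; rewrite !mxE -/D xE; ring.
- rewrite leNgt; apply/negP => s0_lt0.
  have [|t [t_gt0 tk [s [s_ge0 _ /sE]]]] := small (- s0); first by lra.
  by move: tk; rewrite ltr_norml => /andP[_ ? ?]; lra.
- case: w @D acc e1 e2 s1_le1 s2_le1 uE D0 xE sE small => // w' D acc _ _ _ _ _ _ _ sE small.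
  rewrite leNgt; apply/negP => s0_gt1.
  have [|t [t_gt0 tk [s [_ s_le1 /sE]]]] := small (s0 - 1); first by lra.
  by move: tk; rewrite ltr_norml => /andP[? _ ?]; lra.
Qed.

Hypotheses (Eirr : irreflexive (adj E)) (embE : embedded pos E).

(** Some single edge contains points x + e'u for arbitrarily small e'. If it is another edge than
    [vw], then [x] lies on both, so it is an endpoint of [vw], contrary to 0 < t < 1. *)
Lemma embedded_local_dir (v w : V) (t : R) (u : 'rV[R]_n) :
  adj E (inr v) (inr w) -> 0 < t -> t < 1 ->
  (exists2 e, 0 < e & forall e', 0 < e' -> e' < e ->
     L (pos v + t *: (pos w - pos v) + e' *: u)) ->
  exists k, tp_eq u (k *: (pos w - pos v)).
Proof.
move=> vw t_gt0 t_lt1 [e e_gt0 eL]; set x := pos v + t *: _ in eL.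
have [inj_pos meet] := embE.
have [[[v' w'] F_acc]|] := pselect (exists F : V * vertex n V,
    forall e, 0 < e -> exists e', [/\ 0 < e', e' < e &
      adj E (inr F.1) F.2 /\ edge_points pos F.1 F.2 (x + e' *: u)]).
  have [_ [_ _ [v'w' _]]] := F_acc 1 ltr01; rewrite /= in v'w'.
  have [|k [uk [k0|xF]]] := @edge_accumulation v' w' x u.
  - by move=> e1 /F_acc[e' [? ? [? ?]]]; exists e'.
  - exists 0; move/tp_eqP: uk => uk; apply/tp_eqP => i j.
    by rewrite uk k0 !mxE; ring.
  have [eq_edge|neq_edge] := eqVneq [set inr v'; w']%SET [set inr v; inr w]%SET.
    have := set22 (inr v') w'; have := set21 (inr v') w'; rewrite eq_edge.
    rewrite !inE => /orP[] /eqP [ev'] /orP[] /eqP ew'; subst v' w'.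
    - by rewrite Eirr in v'w'.
    - by exists k.
    - exists (- k); move/tp_eqP: uk => uk; apply/tp_eqP => i j.
      by rewrite uk !mxE; ring.
    - by rewrite Eirr in v'w'.
  have xvw : edge_points pos v (inr w) x.
    by exists t; split; [exact: ltW | exact: ltW | exact/tp_eqP].
  have [z [_ z_vw /tp_eqP xz]] := meet _ _ _ _ v'w' vw neq_edge x xF xvw.
  suff /inj_pos ewv : tp_eq (pos w) (pos v) by rewrite ewv Eirr in vw.
  apply/tp_eqP => i j; move: (xz i j); rewrite /x !mxE.
  move: z_vw; rewrite !inE => /orP[] /eqP [->] {}xz.
    apply/eqP; rewrite -subr_eq0; apply/eqP/(mulfI (lt0r_neq0 t_gt0)); lra.
  have t1 : 1 - t != 0 by rewrite subr_eq0 gt_eqF.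
  apply/eqP; rewrite -subr_eq0; apply/eqP/(mulfI t1); lra.
(* If no edge accumulates, all of them, being finitely many, miss x + e'u for small e'. *)
move=> noF; exfalso.
have [|e1 e1_gt0 e1P] := @near0_all (V * vertex n V)%type (fun F e =>
    ~ (adj E (inr F.1) F.2 /\ edge_points pos F.1 F.2 (x + e *: u))).
  move=> F; apply: contrapT => notF; apply: noF; exists F => e1 e1_gt0.
  apply: contrapT => no_e'; apply: notF; exists e1 => // e' e'_gt0 e'_lt Fe'.
  by apply: no_e'; exists e'.
pose e2 := Num.min e e1 / 2.
have min_gt0 : 0 < Num.min e e1 by rewrite lt_min e_gt0.
have e2_gt0 : 0 < e2 by rewrite divr_gt0.
have : e2 < Num.min e e1 by rewrite /e2; lra.
rewrite lt_min => /andP[e2e e2e1].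
have [v' [w' vw']] := eL _ e2_gt0 e2e.
exact: (e1P (v', w') _ e2_gt0 e2e1).
Qed.

End Embedded.
End LocalStructure.
End Geometry.

(** * The splits of a pencil are noncrossing *)

Definition noncrossing (A : pred 'I_6) : Prop :=
  forall i j k l : 'I_6, i < j -> j < k -> k < l ->
    ~~ [&& A i == A k, A j == A l & A i != A j].

Section NoncrossingSplits.
Import Order.TTheory GRing.Theory Num.Theory.
Local Open Scope ring_scope.
Variable R : realType.
Implicit Types (x : 'rV[R]_6) (p q : 'rV[R]_3) (P : 'I_4 -> 'rV[R]_3).

Lemma min_attained_twiceP (I : finType) (f : I -> R) :
  reflect (exists i j, [/\ i != j, forall k, f i <= f k & forall k, f j <= f k])
          (min_attained_twice f).
Proof.
apply: (iffP card_gt1P) => [[i [j [mi mj ij]]]|[i [j [ij mi mj]]]]; exists i, j.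
  by move: mi mj; rewrite !inE => /forallP ? /forallP ?.
by rewrite !inE; split=> //; apply/forallP.
Qed.

Definition conic_min x p : {set 'I_6} :=
  [set i | [forall j, x 0 i + veronese p 0 i <= x 0 j + veronese p 0 j]]%SET.

Lemma conic_minP x p i :
  reflect (forall j, x 0 i + veronese p 0 i <= x 0 j + veronese p 0 j)
          (i \in conic_min x p).
Proof. by rewrite inE; apply: forallP. Qed.

Lemma conic_min_lt x p i j : i \in conic_min x p -> j \notin conic_min x p ->
  x 0 i + veronese p 0 i < x 0 j + veronese p 0 j.
Proof.
move=> /conic_minP i_min jN; rewrite lt_neqAle i_min andbT.
apply: contra jN => /eqP ij; apply/conic_minP => k; rewrite -ij; exact: i_min.
Qed.

(* The chords ac and bd of the Newton triangle share a point; p and q order   *)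
(* the values there of the interpolations along the two chords oppositely.    *)
Lemma conic_min_crossing x p q (a b c d : 'I_6) :
  (a < b)%N -> (b < c)%N -> (c < d)%N ->
  a \in conic_min x p -> c \in conic_min x p ->
  b \notin conic_min x p -> d \notin conic_min x p ->
  b \in conic_min x q -> d \in conic_min x q ->
  a \notin conic_min x q -> c \notin conic_min x q -> False.
Proof.
move=> ab bc cd pa pc pb pd qb qd qa qc.
have pac : x 0 a + veronese p 0 a = x 0 c + veronese p 0 c.
  by apply/le_anti; rewrite (elimT (conic_minP _ _ _) pa) (elimT (conic_minP _ _ _) pc).
have qbd : x 0 b + veronese q 0 b = x 0 d + veronese q 0 d.
  by apply/le_anti; rewrite (elimT (conic_minP _ _ _) qb) (elimT (conic_minP _ _ _) qd).
move: pac qbd (conic_min_lt pa pb) (conic_min_lt pa pd) (conic_min_lt qb qa)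
  (conic_min_lt qb qc) => {pa pc pb pd qb qd qa qc}; rewrite !mxE.
(* As [veronese] is affine in the exponents, the two interpolations differ by an amount independent
   of the point; each of the 15 quadruples is then linear arithmetic. *)
case: a ab => -[|[|[|[|[|[|]]]]]] // i1 ab;
  case: b ab bc => -[|[|[|[|[|[|]]]]]] // i2 _ bc;
  case: c bc cd => -[|[|[|[|[|[|]]]]]] // i3 _ cd;
  case: d cd => -[|[|[|[|[|[|]]]]]] // i4 _ /=; lra.
Qed.

(** At each point the minimal monomials move together, and the strict gap to the others survives a
    small move. *)
Lemma pencil_perturb P x (C : {set 'I_6}) : pencil P x ->
  (forall m i j, i \in conic_min x (P m) -> j \in conic_min x (P m) ->
     (i \in C) = (j \in C)) ->
  exists2 e, 0 < e & forall t, 0 < t -> t < e -> pencil P (x + t *: indic R C).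
Proof.
move=> Px uncut.
have [|e e_gt0 eP] := @near0_all R ('I_4 * 'I_6)%type (fun mk t => forall i,
    i \in conic_min x (P mk.1) -> mk.2 \notin conic_min x (P mk.1) ->
    x 0 i + veronese (P mk.1) 0 i + t <= x 0 mk.2 + veronese (P mk.1) 0 mk.2).
  move=> [m k] /=; have [i [_ [_ /conic_minP i_min _]]] := min_attained_twiceP _ (Px m).
  have [k_min|kN] := boolP (k \in conic_min x (P m)); first by exists 1.
  exists (x 0 k + veronese (P m) 0 k - (x 0 i + veronese (P m) 0 i)).
    by rewrite subr_gt0 conic_min_lt.
  move=> t t_gt0 te j /conic_minP/(_ i) j_min _; lra.
exists e => // t t_gt0 te m.
have [i [j [ij /conic_minP i_min /conic_minP j_min]]] := min_attained_twiceP _ (Px m).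
have stay a : a \in conic_min x (P m) -> forall k,
    (x + t *: indic R C) 0 a + veronese (P m) 0 a <=
    (x + t *: indic R C) 0 k + veronese (P m) 0 k.
  have xE b : (x + t *: indic R C) 0 b = x 0 b + t * (b \in C)%:R by rewrite !mxE.
  move=> a_min k; rewrite !xE.
  have [k_min|kN] := boolP (k \in conic_min x (P m)).
    by have := elimT (conic_minP _ _ _) a_min k; rewrite (uncut m a k) //; lra.
  have := eP (m, k) t t_gt0 te a a_min kN => /=.
  by case: (a \in C); case: (k \in C) => /=; lra.
by apply/min_attained_twiceP; exists i, j; split=> //; exact: stay.
Qed.

(** Along e_A, a monomial in A and one outside tie at a given point for only one parameter. *)
Lemma pencil_unmixed P x (D : 'rV[R]_6) (A : {set 'I_6}) (r : R) : 0 < r ->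
  tp_eq D (r *: indic R A) ->
  exists t, [/\ 0 < t, t < 1 & forall m i j,
    i \in conic_min (x + t *: D) (P m) -> j \in conic_min (x + t *: D) (P m) ->
    (i \in A) = (j \in A)].
Proof.
move=> r_gt0 /tp_eqP DA.
pose f m j := x 0 j + veronese (P m) 0 j.
(* The parameter of the tie at point m between i in A and j outside. *)
pose bad (mij : 'I_4 * 'I_6 * 'I_6) := (f mij.1.1 mij.2 - f mij.1.1 mij.1.2) / r.
have [t [t_gt0 t_lt1 t_avoid]] :=
  avoid_finite [seq bad mij | mij <- enum {: 'I_4 * 'I_6 * 'I_6}] (@ltr01 R).
exists t; split=> //.
suff half m i j : i \in conic_min (x + t *: D) (P m) ->
    j \in conic_min (x + t *: D) (P m) -> i \in A -> j \in A.
  by move=> m i j i_min j_min; apply/idP/idP; apply: half; eassumption.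
move=> /conic_minP/(_ j) ij /conic_minP/(_ i) ji iA; apply: contraT => jA.
case/negP: t_avoid; apply/mapP; exists (m, i, j); first by rewrite mem_enum.
apply: (mulIf (lt0r_neq0 r_gt0)); rewrite divfK ?lt0r_neq0 //= /f.
have xE b : (x + t *: D) 0 b = x 0 b + t * D 0 b by rewrite !mxE.
have SE b : (r *: indic R A) 0 b = r * (b \in A)%:R by rewrite !mxE.
move: (DA i j) ij ji; rewrite !xE !SE iA (negbTE jA) /= => Dij ij ji.
have -> : r = D 0 i - D 0 j by rewrite Dij; ring.
lra.
Qed.

Lemma line_split_noncrossing P (V : finType) (E : lgraph 6 V)
    (pos : V -> 'rV[R]_6) (v w : V) (A : {set 'I_6}) (r : R) :
  irreflexive (adj E) -> embedded pos E ->
  pencil P = [set x | exists v w, adj E (inr v) w /\ edge_points pos v w x]%classic ->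
  adj E (inr v) (inr w) -> 0 < r -> tp_eq (pos w - pos v) (r *: indic R A) ->
  noncrossing (mem A).
Proof.
move=> Eirr embE PL vw r_gt0 DA.
have [t [t_gt0 t_lt1]] := pencil_unmixed P (pos v) r_gt0 DA.
set x := _ + _ => unmixed.
have Px : pencil P x.
  rewrite PL; exists v, (inr w); split=> //; exists t; split; try exact: ltW.
  exact/tp_eqP.
(* Were no minimal set cut by C, moving along e_C would stay in the pencil, so e_C would be parallel
   to e_A, which does not separate i from j. *)
have connected (C : {set 'I_6}) i j : (i \in A) = (j \in A) ->
    i \in C -> j \notin C ->
    exists m (p q : 'I_6), [/\ p \in conic_min x (P m), q \in conic_min x (P m),
      p \in C & q \notin C].
  move=> Aij iC jC; apply: contrapT => no_cut.
  have uncut m (p q : 'I_6) : p \in conic_min x (P m) -> q \in conic_min x (P m) ->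
      (p \in C) = (q \in C).
    move=> p_min q_min; apply/idP/idP => pC; apply: contraT => qC; case: no_cut.
      by exists m, p, q.
    by exists m, q, p.
  have [e e_gt0 eP] := pencil_perturb Px uncut.
  have [|k /tp_eqP/(_ i j)] := @embedded_local_dir R _ _ _ _ Eirr embE v w t (indic R C) vw t_gt0 t_lt1.
    exists e => // e' e'_gt0 e'_lt; have := eP e' e'_gt0 e'_lt.
    by rewrite PL.
  have ZE (y : 'rV[R]_6) a b : (a *: y) 0 b = a * y 0 b by rewrite mxE.
  have indicE (B : {set 'I_6}) b : indic R B 0 b = (b \in B)%:R by rewrite mxE.
  move: DA => /tp_eqP/(_ i j); rewrite !ZE !indicE Aij subrr => /subr0_eq ->.
  by rewrite subrr iC (negbTE jC) /=; lra.
move=> i j k l ij jk kl; apply/negP => /and3P[/eqP Aik /eqP Ajl /eqP Aij].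
rewrite /= in Aik Ajl Aij.
(* Linking j to l yields a chord, minimal at one point, that crosses the chord ik. *)
pose C1 := [set p : 'I_6 | ((p \in A) == (j \in A)) && (i < p < k)%N]%SET.
have [||m1 [r1 [s1 [r1_min s1_min]]]] := connected C1 j l Ajl.
- by rewrite inE eqxx ij jk.
- by rewrite inE; apply/negP => /and3P[_ _]; rewrite ltnNge (ltnW kl).
have r1s1 := unmixed _ _ _ r1_min s1_min.
rewrite !inE -r1s1 => /andP[/eqP Ar1 ir1k]; rewrite Ar1 eqxx /= => s1_out.
have As1 : (s1 \in A) = (j \in A) by rewrite -r1s1.
have neq_side a b : (a \in A) = (i \in A) -> (b \in A) = (j \in A) -> a <> b :> nat.
  by move=> Aa Ab /val_inj ab; apply: Aij; rewrite -Aa -Ab ab.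
have s1i := neq_side i s1 erefl As1; have s1k := neq_side k s1 (esym Aik) As1.
have crossed (lo hi : 'I_6) : (lo \in A) = (j \in A) -> (hi \in A) = (j \in A) ->
    lo \in conic_min x (P m1) -> hi \in conic_min x (P m1) ->
    (i < lo < k)%N && (k < hi)%N || (lo < i < hi)%N && (hi < k)%N -> False.
  move=> Alo Ahi lo_min hi_min between.
  (* Exactly one of i and k lies between [lo] and [hi]; linking i to k yields a minimal chord
     crossing the first one. *)
  pose C2 := [set p : 'I_6 | ((p \in A) == (i \in A)) && (lo < p < hi)%N]%SET.
  have [m2 [p [q [p_min q_min]]]] : exists m (p q : 'I_6), [/\ p \in conic_min x (P m),
      q \in conic_min x (P m), p \in C2 & q \notin C2].
    have C2E a : (a \in A) = (i \in A) -> (a \in C2) = (lo < a < hi)%N.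
      by rewrite inE => ->; rewrite eqxx.
    case/orP: between => between.
      by apply: (connected C2 k i); rewrite // C2E //; move: between; clear; lia.
    by apply: (connected C2 i k); rewrite // C2E //; move: between; clear; lia.
  have pq := unmixed _ _ _ p_min q_min.
  rewrite !inE -pq => /andP[/eqP Ap lophi]; rewrite Ap eqxx /= => q_out.
  have Aq : (q \in A) = (i \in A) by rewrite -pq.
  have qlo := neq_side q lo Aq Alo; have qhi := neq_side q hi Aq Ahi.
  have not_min m a b : (a \in A) = (i \in A) -> (b \in A) = (j \in A) ->
      (a \in conic_min x (P m) -> b \notin conic_min x (P m)) *
      (b \in conic_min x (P m) -> a \notin conic_min x (P m)).
    by move=> Aa Ab; split=> a_min; apply/negP => b_min; apply: Aij;
      rewrite -Aa -Ab; apply: (unmixed m).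
  have [lo_p p_hi] := andP lophi.
  have [q_lo|q_hi] := ltnP q lo.
    apply: (@conic_min_crossing x (P m2) (P m1) q lo p hi) => //.
    - exact: (not_min m2 q lo Aq Alo).1 q_min.
    - exact: (not_min m2 q hi Aq Ahi).1 q_min.
    - exact: (not_min m1 q lo Aq Alo).2 lo_min.
    - exact: (not_min m1 p lo Ap Alo).2 lo_min.
  have hi_q : (hi < q)%N by move: q_out q_hi qlo qhi; clear; lia.
  apply: (@conic_min_crossing x (P m1) (P m2) lo p hi q) => //.
  - exact: (not_min m1 p lo Ap Alo).2 lo_min.
  - exact: (not_min m1 q lo Aq Alo).2 lo_min.
  - exact: (not_min m2 q lo Aq Alo).1 q_min.
  - exact: (not_min m2 q hi Aq Ahi).1 q_min.
have [s1_lo|s1_hi] := ltnP s1 i.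
  by apply: (crossed s1 r1) => //; move: ir1k s1_lo; clear; lia.
by apply: (crossed r1 s1) => //; move: ir1k s1_out s1_hi s1i s1k; clear; lia.
Qed.

End NoncrossingSplits.

(* The internal vertices on the w-side of the edge vw. *)
Definition beyond (star : bool) (v w : 'I_4) : pred 'I_4 := fun x =>
  if star then (if v == ord0 then x == w else x != v)
  else if v < w then w <= x else x <= w.

Definition side (c : bool * seq 'I_4) (v : 'I_4) (u : vertex 6 'I_4) : {set 'I_6} :=
  match u with
  | inl i => [set i]
  | inr w => [set i | beyond c.1 v w (attach c.2 i)]
  end%SET.

(** For adjacent v and w, the greatest distance from w to an internal vertex on the w-side. *)
Definition side_rank (star : bool) (v w : 'I_4) : nat :=
  if star then (v != ord0 : nat) else if v < w then 3 - w else w.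

Lemma ord4_ind (P : 'I_4 -> Prop) :
  P (nth ord0 ords4 0) -> P (nth ord0 ords4 1) -> P (nth ord0 ords4 2) ->
  P (nth ord0 ords4 3) -> forall v, P v.
Proof.
move=> P0 P1 P2 P3 v.
by move: (mem_ords4 v); rewrite !inE; do 4?[case/orP] => /eqP->.
Qed.

Lemma beyond_rec star v w t : shape star v w ->
  nat_of_bool (beyond star v w t) =
  (t == w) + count (fun x => [&& shape star w x, x != v & beyond star w x t]) ords4.
Proof.
by move: v w t; case: star; elim/ord4_ind; elim/ord4_ind => //; elim/ord4_ind.
Qed.

Lemma beyond_partition star v t :
  (t == v) + count (fun x => shape star v x && beyond star v x t) ords4 = 1.
Proof. by move: v t; case: star; elim/ord4_ind; elim/ord4_ind. Qed.

Lemma side_rank_lt star v w x : shape star v w -> shape star w x -> x != v ->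
  side_rank star w x < side_rank star v w.
Proof.
by move: v w x; case: star; elim/ord4_ind; elim/ord4_ind => //; elim/ord4_ind.
Qed.

Lemma sum_adj_attach c (v : 'I_4) (F : vertex 6 'I_4 -> nat) :
  \sum_(x | adj (code_graph c) (inr v) x) F x =
  \sum_(i <- ords6 | attach c.2 i == v) F (inl i)
  + \sum_(w <- ords4 | shape c.1 v w) F (inr w).
Proof.
rewrite big_mkcond big_sumType (perm_big _ perm_ords6) (perm_big _ perm_ords4).
by congr addn; rewrite [RHS]big_mkcond; apply: eq_bigr => i _; rewrite adj_attach.
Qed.

Lemma sum_leaves (P : pred 'I_6) i :
  \sum_(j <- ords6 | P j) (i \in [set j]%SET) = P i.
Proof.
rewrite -(perm_big _ perm_ords6) big_mkcond (bigD1 i) //= finset.in_set1 eqxx.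
rewrite big1 => [|j ji]; first by rewrite addn0; case: (P i).
by rewrite finset.in_set1 eq_sym (negbTE ji) if_same.
Qed.

Lemma side_rec c v w i : adj (code_graph c) (inr v) (inr w) ->
  nat_of_bool (i \in side c v (inr w)) =
  \sum_(x | adj (code_graph c) (inr w) x && (x != inr v)) (i \in side c w x).
Proof.
rewrite adj_attach inE => vw; rewrite beyond_rec // big_mkcondr sum_adj_attach.
congr addn; last first.
  rewrite -sum1_count big_mkcond [RHS]big_mkcond; apply: eq_bigr => x _.
  rewrite inE; change (inr x != inr v :> vertex 6 'I_4) with (x != v).
  by case: (shape _ _ _); case: (x != v); case: (beyond _ _ _ _).
by rewrite -(sum_leaves (fun j => attach c.2 j == w)); apply: eq_bigr => j _.
Qed.

(** Removing v distributes the leaves among its edges. The indicators thus sum to (1,...,1), which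
    is balancing for the certificates. *)
Lemma side_partition c v i :
  \sum_(x | adj (code_graph c) (inr v) x) (i \in side c v x) = 1.
Proof.
rewrite sum_adj_attach; apply: etrans (beyond_partition c.1 v (attach c.2 i)).
congr addn.
  exact: (sum_leaves (fun j => attach c.2 j == v)).
rewrite -sum1_count big_mkcond [RHS]big_mkcond; apply: eq_bigr => x _.
by rewrite inE; case: (shape _ _ _); case: (beyond _ _ _ _).
Qed.

Lemma cubic_attach c t : cubic c -> t \in leaf_word c.1 -> exists i, attach c.2 i = t.
Proof.
case: c => star w cub; rewrite -(perm_mem cub) => t_in.
have idx : index t w < 6 by rewrite -(cubic_size cub) index_mem.
by exists (Ordinal idx); rewrite /attach nth_index.
Qed.

Lemma side_proper c v u : cubic c -> adj (code_graph c) (inr v) u ->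
  exists a b, a \in side c v u /\ b \notin side c v u.
Proof.
move=> cub; rewrite adj_attach; case: u => [i _|w /= vw].
  exists i, (if i == ord0 then ord_max else ord0); rewrite !inE eqxx.
  by split=> //; case: ifP => [/eqP->|/negbT]; rewrite // eq_sym.
have /andP[/hasP[s /(cubic_attach cub)[a <-] sa] /hasP[t /(cubic_attach cub)[b <-] tb]] :
    has (beyond c.1 v w) (leaf_word c.1) && has (predC (beyond c.1 v w)) (leaf_word c.1).
  by move: vw; move: v w; case: (c.1); elim/ord4_ind; elim/ord4_ind.
by exists a, b; rewrite !inE.
Qed.

Definition noncrossingb (A : pred 'I_6) : bool :=
  all (fun i : 'I_6 => all (fun j : 'I_6 => if i < j then
    all (fun k : 'I_6 => if j < k then
      all (fun l : 'I_6 => if k < l then ~~ [&& A i == A k, A j == A l & A i != A j]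
        else true) ords6
      else true) ords6
    else true) ords6) ords6.

Lemma noncrossing_bool A : noncrossing A -> noncrossingb A.
Proof.
move=> ncA; apply/all_ords6P => i; apply/all_ords6P => j; case: ifP => // ij.
apply/all_ords6P => k; case: ifP => // jk; apply/all_ords6P => l; case: ifP => // kl.
exact: ncA.
Qed.

Definition noncrossing_code (c : bool * seq 'I_4) : bool :=
  all (fun v => all (fun w => if shape c.1 v w
    then noncrossingb (fun i => beyond c.1 v w (attach c.2 i)) else true) ords4) ords4.

(** 14 is the number of triangulations of a hexagon; the stars come from the two with a triangle of
    three diagonals. *)
Lemma size_noncrossing_codes :
  [/\ count noncrossing_code tree_codes = 14,
      count (fun c => noncrossing_code c && ~~ c.1) tree_codes = 12
    & count (fun c => noncrossing_code c && c.1) tree_codes = 2].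
Proof. by split; vm_compute. Qed.

Lemma adj_code_sym c : symmetric (adj (code_graph c)).
Proof.
by move=> [i|v] [j|w]; rewrite !adj_attach //= shape_sym.
Qed.

Lemma realizable_noncrossing (R : realType) c : cubic c ->
  realizable R (code_graph c) -> noncrossing_code c.
Proof.
move=> cub [P [_ [_ [pos [emb bal PL]]]]].
apply/all_ords4P => v; apply/all_ords4P => w; case: ifP => // vw.
have E_vw : adj (code_graph c) (inr v) (inr w) by rewrite adj_attach.
have [|||r r_gt0 dir] := @balanced_edge_dir R 6 'I_4 (code_graph c) pos (side c)
  (side_rank c.1) (@adj_code_sym c) (fun _ _ => erefl) _ _ _ bal v (inr w) E_vw.
- by move=> a b; exact: side_proper.
- by move=> a b i; exact: side_rec.
- by move=> a b x; rewrite !adj_attach /=; exact: side_rank_lt.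
have irr : irreflexive (adj (code_graph c)).
  by move=> [i|x]; rewrite adj_attach //= shape_irr.
have nc := line_split_noncrossing irr emb PL E_vw r_gt0 dir.
apply: noncrossing_bool => i j k l ij jk kl.
by have := nc i j k l ij jk kl; rewrite /= !inE.
Qed.

(** * Difference bounds *)

Section DifferenceBounds.

(* Entry (i, j) of a bound matrix is an upper bound of x_i - x_j, where None  *)
(* stands for +oo.                                                            *)
Definition bounds := seq (seq (option Z)).

Definition bound (D : bounds) (i j : 'I_6) : option Z := nth None (nth [::] D i) j.

Definition tabulate (F : 'I_6 -> 'I_6 -> option Z) : bounds :=
  [seq [seq F i j | j <- ords6] | i <- ords6].

Lemma bound_tabulate F i j : bound (tabulate F) i j = F i j.
Proof.
have nthE (k : 'I_6) : nth ord0 ords6 k = k.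
  by apply: val_inj; case: k => -[|[|[|[|[|[|]]]]]].
by rewrite /bound /tabulate !(nth_map ord0) ?nthE.
Qed.

Definition entails (o : option Z) (c : Z) : bool :=
  if o is Some d then Z.leb d c else false.

(** The bound on x_a - x_b obtained by adding bounds on x_a - x_i, x_i - x_j and x_j - x_b: one
    relaxation of shortest paths. *)
Definition via (o1 : option Z) (c : Z) (o2 : option Z) : option Z :=
  if o1 is Some d1 then if o2 is Some d2 then Some (Z.add (Z.add d1 c) d2) else None else None.

Definition omin (o1 o2 : option Z) : option Z :=
  match o1, o2 with
  | Some d1, Some d2 => Some (Z.min d1 d2)
  | Some d, None | None, Some d => Some d
  | None, None => None
  end.

(* None is returned when the new bound creates a negative cycle. *)
Definition tighten (o : option bounds) (k : 'I_6 * 'I_6 * Z) : option bounds :=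
  let: (i, j, c) := k in
  if o is Some D then
    if entails (bound D i j) c then Some D
    else if (if bound D j i is Some d then Z.ltb (Z.add d c) Z0 else false) then None
    else Some (tabulate (fun a b => omin (bound D a b) (via (bound D a i) c (bound D j b))))
  else None.

Definition bound_list (D : bounds) : seq ('I_6 * 'I_6 * Z) :=
  pmap (fun ij => omap (pair ij) (bound D ij.1 ij.2)) [seq (i, j) | i <- ords6, j <- ords6].

Definition trivial_bounds : bounds :=
  tabulate (fun i j => if i == j then Some Z0 else None).

(* The difference bounds saying that the minimum of x_l + r_l is attained at  *)
(* both i and j.                                                              *)
Definition min_bounds (r : seq Z) (ij : 'I_6 * 'I_6) : seq ('I_6 * 'I_6 * Z) :=
  [seq (p, l, Z.sub (nth Z0 r l) (nth Z0 r p)) | p : 'I_6 <- [:: ij.1; ij.2], l : 'I_6 <- ords6].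

Definition pairs6 : seq ('I_6 * 'I_6) :=
  [seq ij : 'I_6 * 'I_6 <- [seq (i, j) | i <- ords6, j <- ords6] | ij.1 < ij.2].

(* Branches over the pairs of ps that attain the minimum of a row, pruning    *)
(* the infeasible cells.                                                      *)
Fixpoint covered_by (ps : seq ('I_6 * 'I_6)) (F : seq bounds) (D : bounds)
    (rs : seq (seq Z)) : bool :=
  if rs is r :: rs' then
    all (fun ij => if foldl tighten (Some D) (min_bounds r ij) is Some D'
                   then covered_by ps F D' rs' else true) ps
  else has (fun D' => all (fun k => entails (bound D k.1.1 k.1.2) k.2) (bound_list D')) F.

Definition covered := covered_by pairs6.

(** * Soundness of the difference bounds *)

Section Semantics.
Import Order.TTheory GRing.Theory Num.Theory.
Local Open Scope ring_scope.
Variable R : realType.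
Implicit Types (x : 'rV[R]_6) (D : bounds).

Definition zr (a : Z) : R := (int_of_Z a)%:~R.

Lemma zrD a b : zr (Z.add a b) = zr a + zr b.
Proof. by rewrite /zr -intrD; congr (_%:~R); lia. Qed.

Lemma zrB a b : zr (Z.sub a b) = zr a - zr b.
Proof. by rewrite /zr -intrB; congr (_%:~R); lia. Qed.

Lemma zr0 : zr Z0 = 0. Proof. by []. Qed.

Lemma zr_le a b : (zr a <= zr b) = Z.leb a b.
Proof. by rewrite /zr ler_int; lia. Qed.

Lemma zr_lt a b : (zr a < zr b) = Z.ltb a b.
Proof. by rewrite /zr ltr_int; lia. Qed.

Lemma zr_inj : injective zr.
Proof.
move=> a b ab; have := zr_le a b; have := zr_le b a.
by rewrite ab lexx; lia.
Qed.

Definition holds x (k : 'I_6 * 'I_6 * Z) : Prop := x 0 k.1.1 - x 0 k.1.2 <= zr k.2.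

Definition within x D : Prop := forall k, k \in bound_list D -> holds x k.

Lemma mem_bound_list D i j c : ((i, j, c) \in bound_list D) = (bound D i j == Some c).
Proof.
rewrite mem_pmap; apply/mapP/eqP => [[[a b] _ /=]|Dij].
  by case Dab: (bound D a b) => [d|] //= [-> -> ->].
exists (i, j); last by rewrite /= Dij.
by apply: (allpairs_f pair); exact: mem_ords6.
Qed.

Lemma withinP x D :
  within x D <-> forall i j c, bound D i j = Some c -> x 0 i - x 0 j <= zr c.
Proof.
split=> [xD i j c Dij|xD [[i j] c]]; last by rewrite mem_bound_list => /eqP; exact: xD.
by apply: (xD (i, j, c)); rewrite mem_bound_list Dij.
Qed.

Lemma entails_holds x D (k : 'I_6 * 'I_6 * Z) :
  within x D -> entails (bound D k.1.1 k.1.2) k.2 -> holds x k.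
Proof.
case: k => -[i j] c /withinP/(_ i j) /=; case: (bound D i j) => //= d /(_ d erefl) xd.
by rewrite -zr_le; exact: le_trans.
Qed.

Lemma tighten_within x D k : within x D -> holds x k ->
  exists2 D', tighten (Some D) k = Some D' & within x D'.
Proof.
case: k => -[i j] c xD; rewrite /holds /= => xc; have /withinP xDP := xD.
case: ifP => _; first by exists D.
case: ifP => [|_].
  case Dji: (bound D j i) => [d|] //; rewrite -zr_lt zrD zr0 => dc.
  by have := xDP _ _ _ Dji; lra.
eexists; first by [].
apply/withinP => a b e; rewrite bound_tabulate.
case Dab: (bound D a b) => [d|]; case Dai: (bound D a i) => [d1|];
  case Djb: (bound D j b) => [d2|] //= [<-]; try exact: xDP;
  have := xDP _ _ _ Dai; have := xDP _ _ _ Djb => h1 h2.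
  have [m|m] : Z.min d (Z.add (Z.add d1 c) d2) = d \/
    Z.min d (Z.add (Z.add d1 c) d2) = Z.add (Z.add d1 c) d2 by lia.
    by rewrite m; exact: xDP.
  by rewrite m !zrD; lra.
by rewrite !zrD; lra.
Qed.

Lemma tighten_all x D ks : within x D -> (forall k, k \in ks -> holds x k) ->
  exists2 D', foldl tighten (Some D) ks = Some D' & within x D'.
Proof.
elim: ks D => [|k ks IH] D xD xks; first by exists D.
have [D1 D1E xD1] := tighten_within xD (xks k (mem_head _ _)).
rewrite [foldl _ _ _]/= -/(tighten (Some D) k) D1E; apply: IH => // k' k'_in.
by apply: xks; rewrite inE k'_in orbT.
Qed.

Definition min_at_both x (r : seq Z) (i j : 'I_6) : Prop := forall l : 'I_6,
  x 0 i + zr (nth Z0 r i) <= x 0 l + zr (nth Z0 r l) /\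
  x 0 j + zr (nth Z0 r j) <= x 0 l + zr (nth Z0 r l).

Lemma min_boundsP x (r : seq Z) (i j : 'I_6) :
  (forall k, k \in min_bounds r (i, j) -> holds x k) <-> min_at_both x r i j.
Proof.
have mem (p l : 'I_6) : p \in [:: i; j] ->
    (p, l, Z.sub (nth Z0 r l) (nth Z0 r p)) \in min_bounds r (i, j).
  by move=> pij; apply: (allpairs_f (fun p l : 'I_6 => (p, l, Z.sub (nth Z0 r l) (nth Z0 r p)))) => //;
    exact: mem_ords6.
split=> [xk l|xk k /allpairsP[[p l] [/= pij _ ->]]]; rewrite /holds /=.
  have := xk _ (mem i l _); have := xk _ (mem j l _).
  by rewrite !inE !eqxx ?orbT /holds /= !zrB => /(_ isT) ? /(_ isT) ?; lra.
have [] := xk l; move: pij; rewrite !inE zrB => /orP[] /eqP ->; lra.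
Qed.

Lemma min_attained_twice_pair x (r : seq Z) :
  min_attained_twice (fun j : 'I_6 => x 0 j + zr (nth Z0 r j)) <->
  exists2 ij, ij \in pairs6 & min_at_both x r ij.1 ij.2.
Proof.
have in_pairs (i j : 'I_6) : (i < j)%N -> (i, j) \in pairs6.
  by move=> ij; rewrite mem_filter ij; apply: (allpairs_f pair); exact: mem_ords6.
split=> [/min_attained_twiceP[i [j [ij i_min j_min]]]|[[i j]]].
  move: ij; rewrite -val_eqE neq_ltn => /orP[] ij.
    by exists (i, j) => [|l]; [exact: in_pairs | split].
  by exists (j, i) => [|l]; [exact: in_pairs | split].
rewrite mem_filter => /andP[/= ij _] x_min; apply/min_attained_twiceP; exists i, j.
split=> [|k|k]; first by rewrite -val_eqE neq_ltn ij.
  by have [] := x_min k.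
by have [] := x_min k.
Qed.

(** Each row has a pair attaining its minimum at [x]; following these pairs leads to a branch that
    is feasible, since [x] lies in it, and so ends within a member of [F]. *)
Lemma coveredP x F D rs : covered F D rs -> within x D ->
  (forall r, r \in rs -> min_attained_twice (fun j : 'I_6 => x 0 j + zr (nth Z0 r j))) ->
  exists2 D', D' \in F & within x D'.
Proof.
rewrite /covered; elim: rs D => [|r rs IH] D.
  move=> /hasP[D' D'_in /allP DD'] xD _; exists D' => // k k_in.
  exact: entails_holds (DD' k k_in).
move=> /allP cov xD x_min.
have /min_attained_twice_pair[[i j] ij_in /min_boundsP ks] := x_min r (mem_head _ _).
have [D' D'E xD'] := tighten_all xD ks.
move: (cov _ ij_in); rewrite D'E => cov'; apply: IH cov' xD' _ => r' r'_in.
by apply: x_min; rewrite inE r'_in orbT.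
Qed.

Lemma within_trivial x : within x trivial_bounds.
Proof.
apply/withinP => i j c; rewrite bound_tabulate; case: eqP => // -> [<-].
by rewrite subrr zr0.
Qed.

End Semantics.
End DifferenceBounds.

(** * Pencils realizing the noncrossing trees *)

Section WitnessChecker.
Variables (c : bool * seq 'I_4) (P : seq (Z * Z)) (V : seq (seq Z)).

(* The point with index m is (x, y, 0), so these are the entries of row m.    *)
Definition monomials (m : 'I_4) : seq Z :=
  let p := nth (Z0, Z0) P m in
  [:: Z.add p.1 p.1; Z.add p.1 p.2; Z.add p.2 p.2; p.2; Z0; p.1].

Definition cost (f : seq 'I_6) (s : seq 'I_4) : Z :=
  foldr Z.add Z0
    [seq nth Z0 (monomials m) (nth ord0 f (nth ord0 s m)) | m : 'I_4 <- ords4].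

Definition unique_optimum (f : seq 'I_6) : bool :=
  has (fun s => all (fun t => (s == t) || Z.ltb (cost f s) (cost f t)) relabelings)
    relabelings.

Definition generic_check : bool :=
  all (fun i : 'I_6 => all (fun j : 'I_6 => if i < j then
    all (fun k : 'I_6 => if j < k then
      all (fun l : 'I_6 => if k < l then unique_optimum [:: i; j; k; l] else true)
        ords6 else true) ords6 else true) ords6) ords6.

Definition coord (v : 'I_4) (j : 'I_6) : Z := nth Z0 (nth [::] V v) j.

Definition gap (v : 'I_4) (i j : 'I_6) : Z := Z.sub (coord v i) (coord v j).

Definition inside (v : 'I_4) (u : vertex 6 'I_4) : pred 'I_6 :=
  match u with
  | inl i => fun j => j == i
  | inr w => fun j => beyond c.1 v w (attach c.2 j)
  end.

(** If the displacement is len e_A, its coordinate differences are 0 and plus or minus len, so the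
    maximum recovers len; [direction_check] confirms this form. *)
Definition edge_len (v w : 'I_4) : Z :=
  foldr Z.max Z0 [seq Z.sub (gap w i j) (gap v i j) | i <- ords6, j <- ords6].

Definition direction_check (v w : 'I_4) : bool :=
  Z.ltb Z0 (edge_len v w) &&
  all (fun i => all (fun j =>
    Z.eqb (Z.sub (gap w i j) (gap v i j))
      (match inside v (inr w) i, inside v (inr w) j with
       | true, false => edge_len v w
       | false, true => Z.opp (edge_len v w)
       | _, _ => Z0
       end)) ords6) ords6.

(** Along t e_A the difference x_i - x_j grows only for i in A and j outside, up to the length on a
    segment and without bound on a half ray. *)
Definition edge_bounds (e : 'I_4 * vertex 6 'I_4) : bounds :=
  let len := if e.2 is inr w then Some (edge_len e.1 w) else None in
  tabulate (fun i j =>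
    if inside e.1 e.2 i && ~~ inside e.1 e.2 j then omap (Z.add (gap e.1 i j)) len
    else Some (gap e.1 i j)).

Definition code_edges : seq ('I_4 * vertex 6 'I_4) :=
  [seq e : 'I_4 * vertex 6 'I_4 <-
     [seq (v, u) | v <- ords4, u <- map inl ords6 ++ map inr ords4]
     | attach_adj (attach c.2) (shape c.1) (inr e.1) e.2].

Definition same_edge (e e' : 'I_4 * vertex 6 'I_4) : bool :=
  (inr e.1 == inr e'.1 :> vertex 6 'I_4) && (e.2 == e'.2)
  || (inr e.1 == e'.2) && (e.2 == inr e'.1).

Definition endpoint (v : 'I_4) (e : 'I_4 * vertex 6 'I_4) : bool :=
  (v == e.1) || (inr v == e.2).

(** Joining the bounds of two distinct edges must be infeasible or pin the point to a common
    endpoint: upper bounds on x_i - x_j for all ordered pairs force equality. *)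
Definition disjoint_check (eD eD' : ('I_4 * vertex 6 'I_4) * bounds) : bool :=
  let: (e, D) := eD in let: (e', D') := eD' in
  if same_edge e e' then true
  else if foldl tighten (Some D) (bound_list D') is Some D''
  then has (fun v => [&& endpoint v e, endpoint v e' &
         all (fun i => all (fun j => entails (bound D'' i j) (gap v i j)) ords6) ords6])
       ords4
  else true.

(** One pair of monomials must attain the minimum along the whole edge. *)
Definition on_pencil_check (D : bounds) (r : seq Z) : bool :=
  has (fun ij => all (fun k => entails (bound D k.1.1 k.1.2) k.2) (min_bounds r ij))
    pairs6.

Definition witness_check : bool :=
  let rows := [seq monomials m | m <- ords4] in
  let edges := [seq (e, edge_bounds e) | e <- code_edges] in
  [&& generic_check,
      all (fun v => all (fun w => if shape c.1 v w then direction_check v w else true)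
        ords4) ords4,
      all (fun v => all (fun w => (v == w) ||
        has (fun i => has (fun j => ~~ Z.eqb (gap v i j) (gap w i j)) ords6) ords6)
        ords4) ords4,
      all (fun eD => all (disjoint_check eD) edges) edges,
      all (fun eD => all (on_pencil_check eD.2) rows) edges
    & covered [seq eD.2 | eD <- edges] trivial_bounds rows].

End WitnessChecker.

Definition witness_point (R : realType) (P : seq (Z * Z)) (m : 'I_4) : 'rV[R]_3 :=
  \row_j nth 0%R [:: zr R (nth (Z0, Z0) P m).1; zr R (nth (Z0, Z0) P m).2; 0%R] j.

Definition witness_pos (R : realType) (V : seq (seq Z)) (v : 'I_4) : 'rV[R]_6 :=
  \row_j zr R (coord V v j).

(** * Soundness of the certificates *)

Section WitnessSoundness.
Import Order.TTheory GRing.Theory Num.Theory.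
Local Open Scope ring_scope.
Variables (R : realType) (c : bool * seq 'I_4) (P : seq (Z * Z)) (V : seq (seq Z)).
Hypothesis cub : cubic c.

Local Notation pt := (witness_point R P).
Local Notation pos := (witness_pos R V).

Lemma veronese_witness m j : veronese (pt m) 0 j = zr R (nth Z0 (monomials P m) j).
Proof.
rewrite !mxE /=; case: j => -[|[|[|[|[|[|]]]]]] //= _; rewrite ?zrD ?zr0 //; ring.
Qed.

Lemma witness_pos_gap v i j : pos v 0 i - pos v 0 j = zr R (gap V v i j).
Proof. by rewrite !mxE zrB. Qed.

Lemma in_side v u i : (i \in side c v u) = inside c v u i.
Proof. by case: u => [k|w]; rewrite !inE. Qed.

Lemma direction_checkP v w : direction_check c V v w ->
  0 < zr R (edge_len V v w) /\
  tp_eq (pos w - pos v) (zr R (edge_len V v w) *: indic R (side c v (inr w))).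
Proof.
move=> /andP[len_gt0 /all_ords6P dirs]; rewrite -[0]/(zr R Z0) zr_lt; split=> //.
apply/tp_eqP => i j; move: (dirs i) => /all_ords6P/(_ j)/Z.eqb_eq.
have -> : (pos w - pos v) 0 i - (pos w - pos v) 0 j
          = zr R (Z.sub (gap V w i j) (gap V v i j)).
  by rewrite zrB -!witness_pos_gap !mxE; ring.
move=> ->; have ZE (y : 'rV[R]_6) a b : (a *: y) 0 b = a * y 0 b by rewrite mxE.
have indicE k : indic R (side c v (inr w)) 0 k = (inside c v (inr w) k)%:R.
  by rewrite mxE in_side.
rewrite !ZE !indicE; case: (inside _ _ _ i); case: (inside _ _ _ j) => /=;
  rewrite ?zr0 ?mulr1 ?mulr0 ?subrr ?subr0 //.
by rewrite -[Z.opp _]Z.sub_0_l zrB zr0.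
Qed.

Lemma within_edge_bounds (v : 'I_4) (u : vertex 6 'I_4) (x : 'rV[R]_6) :
  adj (code_graph c) (inr v) u ->
  within x (edge_bounds c V (v, u)) <->
  exists t, [/\ 0 <= t, (if u is inr w then t <= zr R (edge_len V v w) else true)
    & tp_eq x (pos v + t *: indic R (side c v u))].
Proof.
move=> vu; have xE t k : (pos v + t *: indic R (side c v u)) 0 k
    = pos v 0 k + t * (inside c v u k)%:R.
  by rewrite !mxE in_side.
split=> [/withinP xD|[t [t_ge0 t_le /tp_eqP xt]]]; last first.
  apply/withinP => i j d; rewrite bound_tabulate /= xt !xE.
  have := witness_pos_gap v i j; case: (inside c v u i); case: (inside c v u j) => /= gij.
  - by move=> [<-]; lra.
  - by case: u t_le {vu xt xE} => // w t_le [<-]; rewrite zrD; lra.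
  - by move=> [<-]; lra.
  - by move=> [<-]; lra.
have [a [b [aS bS]]] := side_proper cub vu.
rewrite in_side in aS; rewrite in_side in bS.
have same i j : inside c v u i = inside c v u j -> x 0 i - x 0 j = pos v 0 i - pos v 0 j.
  move=> ij; have := xD i j; have := xD j i; rewrite !bound_tabulate /= ij.
  rewrite andbN => /(_ _ erefl) ji /(_ _ erefl) ij'.
  by have := witness_pos_gap v i j; have := witness_pos_gap v j i; lra.
(* The parameter is the growth of any difference leading from inside to outside the side. *)
exists (x 0 a - x 0 b - (pos v 0 a - pos v 0 b)); split.
- have := xD b a; rewrite bound_tabulate /= (negbTE bS) => /(_ _ erefl).
  by have := witness_pos_gap v b a; lra.
- case: u aS bS xD {vu xE same} => // w aS bS xD.
  have := xD a b; rewrite bound_tabulate /= in aS bS *; rewrite aS bS.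
  by move=> /(_ _ erefl); rewrite zrD; have := witness_pos_gap v a b; lra.
apply/tp_eqP => i j; rewrite !xE.
case Si: (inside c v u i); case Sj: (inside c v u j) => /=.
- by rewrite same ?Si ?Sj //; lra.
- have := same i a; have := same j b; rewrite Si Sj aS (negbTE bS).
  by move=> /(_ erefl) ? /(_ erefl) ?; lra.
- have := same i b; have := same j a; rewrite Si Sj aS (negbTE bS).
  by move=> /(_ erefl) ? /(_ erefl) ?; lra.
- by rewrite same ?Si ?Sj //; lra.
Qed.

Lemma edge_dir_leaf (v : 'I_4) i : edge_dir pos v (inl i) = indic R (side c v (inl i)).
Proof. by apply/rowP => j; rewrite !mxE /= inE. Qed.

Hypothesis dirs_ok : forall v w, shape c.1 v w -> direction_check c V v w.

Lemma within_edge_points v u x : adj (code_graph c) (inr v) u ->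
  within x (edge_bounds c V (v, u)) <-> edge_points pos v u x.
Proof.
move=> vu; rewrite within_edge_bounds //; case: u vu => [i|w] vu.
  by rewrite /edge_points -edge_dir_leaf.
have [|len_gt0 /tp_eqP dirE] := @direction_checkP v w.
  by apply: dirs_ok; rewrite adj_attach in vu.
split=> -[t [t_ge0 t_le /tp_eqP xt]].
  (* A segment is parametrized by [0, 1] in [edge_points] and by its lattice length in
     [edge_bounds]. *)
  exists (t / zr R (edge_len V v w)); split.
  - exact: divr_ge0 t_ge0 (ltW len_gt0).
  - by rewrite ler_pdivrMr // mul1r.
  apply/tp_eqP => i j; rewrite xt; move: (dirE i j).
  have ZE (y z : 'rV[R]_6) a b : (y + a *: z) 0 b = y 0 b + a * z 0 b by rewrite !mxE.
  have ZE' (z : 'rV[R]_6) a b : (a *: z) 0 b = a * z 0 b by rewrite !mxE.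
  rewrite /edge_dir !ZE !ZE' => d.
  have {}d : t / zr R (edge_len V v w) * ((pos w - pos v) 0 i - (pos w - pos v) 0 j)
      = t * (indic R (side c v (inr w)) 0 i - indic R (side c v (inr w)) 0 j).
    by rewrite d; field; rewrite lt0r_neq0.
  by move: d; rewrite !mulrBr => d; lra.
exists (t * zr R (edge_len V v w)); split.
- exact: mulr_ge0 t_ge0 (ltW len_gt0).
- by rewrite -[leRHS]mul1r ler_pM2r.
apply/tp_eqP => i j; rewrite xt; move: (dirE i j).
have ZE (y z : 'rV[R]_6) a b : (y + a *: z) 0 b = y 0 b + a * z 0 b by rewrite !mxE.
have ZE' (z : 'rV[R]_6) a b : (a *: z) 0 b = a * z 0 b by rewrite !mxE.
rewrite /edge_dir !ZE !ZE' => d.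
have {}d : t * ((pos w - pos v) 0 i - (pos w - pos v) 0 j)
    = t * zr R (edge_len V v w)
      * (indic R (side c v (inr w)) 0 i - indic R (side c v (inr w)) 0 j).
  by rewrite d; ring.
by move: d; rewrite !mulrBr => d; lra.
Qed.

Lemma balanced_code : balanced pos (code_graph c).
Proof.
exists (fun v u => \row_i (i \in side c v u)%:R); split=> [v u vu|v].
  split.
    move=> k f d /rowP dE; have [a [b [aS bS]]] := side_proper cub vu.
    have := dE a; have := dE b.
    rewrite !mxE !mulmxnE aS (negbTE bS) /= => fb fa.
    (* Coordinates inside and outside the side differ by 1, so k divides 1. *)
    have : (f 0 a - f 0 b) *+ k = 1 by rewrite mulrnBl; lia.
    rewrite -mulr_natr natz => /(congr1 absz); rewrite abszM /= => /eqP.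
    by rewrite muln_eq1 => /andP[_ /eqP].
  have mapE : map_mx intr (\row_i (i \in side c v u)%:R) = indic R (side c v u).
    by apply/rowP => i; rewrite !mxE; case: (i \in _).
  case: u vu mapE => [i|w] vu mapE.
    by exists 1; rewrite // mapE -edge_dir_leaf; apply/tp_eqP => a b; rewrite scale1r.
  have [|len_gt0 dirE] := @direction_checkP v w.
    by apply: dirs_ok; rewrite adj_attach in vu.
  by exists (zr R (edge_len V v w)); rewrite // mapE.
exists 1; apply/rowP => i; rewrite summxE mxE.
under eq_bigr do rewrite mxE.
by rewrite -natr_sum side_partition.
Qed.

End WitnessSoundness.

Section WitnessRealizes.
Import Order.TTheory GRing.Theory Num.Theory.
Local Open Scope ring_scope.
Variables (R : realType) (c : bool * seq 'I_4) (P : seq (Z * Z)) (V : seq (seq Z)).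

Local Notation pt := (witness_point R P).
Local Notation pos := (witness_pos R V).

(** A word strictly cheaper than all others is the only minimizing permutation. *)
Lemma generic_checkP : generic_check P -> generic pt.
Proof.
move=> gen f f_mono; pose fs := [seq f m | m <- ords4].
have opt : unique_optimum P fs.
  have lt (a b : 'I_4) : (a < b)%N -> (f a < f b)%N by exact: f_mono.
  pose o := nth ord0 ords4.
  move: gen => /all_ords6P/(_ (f (o 0%N)))/all_ords6P/(_ (f (o 1%N))).
  rewrite lt // => /all_ords6P/(_ (f (o 2%N))).
  by rewrite lt // => /all_ords6P/(_ (f (o 3%N))); rewrite lt.
have costE (s : {perm 'I_4}) w : s =1 apply_word w ->
    \sum_i colsub f (conic_matrix pt) i (s i) = zr R (cost P fs w).
  move=> sw; rewrite (perm_big _ perm_ords4) /cost.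
  elim: ords4 => [|m l IH]; first by rewrite big_nil.
  rewrite big_cons IH [foldr _ _ _]/= zrD; congr (_ + _).
  have -> : colsub f (conic_matrix pt) m (s m) = veronese (pt m) 0 (f (s m)).
    by rewrite mxE [LHS]mxE.
  rewrite veronese_witness sw; congr (zr R (nth Z0 _ (val _))).
  rewrite /fs (nth_map ord0) ?ltn_ord //; congr f.
  by rewrite /apply_word; elim/ord4_ind: (nth _ _ _).
apply/negP => /min_attained_twiceP[s [t [st s_min t_min]]].
move: opt => /hasP[w /relabeling_perm[r rw] /allP w_opt].
have word (q : {perm 'I_4}) : exists2 w', w' \in relabelings & q =1 apply_word w'.
  exists [seq q v | v <- ords4]; last first.
    by move=> v; rewrite /apply_word; elim/ord4_ind: v.
  rewrite mem_permutations; apply: uniq_perm => //.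
    by rewrite map_inj_uniq //; exact: perm_inj.
  move=> v; rewrite mem_ords4; apply/mapP; exists ((q^-1)%g v); rewrite ?mem_ords4 //.
  by rewrite permKV.
have is_w (q : {perm 'I_4}) :
    (forall k : {perm 'I_4}, \sum_i colsub f (conic_matrix pt) i (q i) <=
       \sum_i colsub f (conic_matrix pt) i (k i)) -> q =1 apply_word w.
  move=> q_min; have [w' w'_in qw'] := word q.
  move: (w_opt w' w'_in) => /orP[/eqP-> //|].
  rewrite -(zr_lt R) -(costE _ _ rw) -(costE _ _ qw') ltNge.
  by rewrite q_min.
case/eqP: st; apply/permP => v.
by rewrite (is_w s s_min) (is_w t t_min).
Qed.

Hypotheses (cub : cubic c) (ok : witness_check c P V).

Lemma witness_realizable : realizable R (code_graph c).
Proof.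
move: ok => /andP[gen /and5P[dirs distinct disjoint on_pencil cover]].
have dirs_ok v w : shape c.1 v w -> direction_check c V v w.
  by move=> vw; move: dirs => /all_ords4P/(_ v)/all_ords4P/(_ w); rewrite vw.
have edgesP v u : adj (code_graph c) (inr v) u = ((v, u) \in code_edges c).
  rewrite mem_filter adj_attach andb_idr // => _.
  apply: (allpairs_f pair); first exact: mem_ords4.
  rewrite mem_cat; case: u => [i|w].
    by rewrite map_f ?mem_ords6.
  by rewrite orbC map_f ?mem_ords4.
have edge_within v u x : adj (code_graph c) (inr v) u ->
    within x (edge_bounds c V (v, u)) <-> edge_points pos v u x.
  exact: within_edge_points.
have ptE m (x : 'rV[R]_6) : on_conic x (pt m) =
    min_attained_twice (fun j : 'I_6 => x 0 j + zr R (nth Z0 (monomials P m) j)).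
  by congr min_attained_twice; apply/funext => j; rewrite veronese_witness.
exists pt; split; first exact: generic_checkP.
split; first by have [] := trivalent6_code cub.
exists pos; split; last 1 first.
- apply/seteqP; split=> x /=.
    move=> Px; have [||D] := @coveredP R x _ _ _ cover.
    + exact: within_trivial.
    + by move=> r /mapP[m _ ->]; rewrite -ptE; exact: Px.
    rewrite -map_comp => /mapP[[v u] vu ->] xD; exists v, u; rewrite edgesP; split=> //.
    by apply/edge_within; rewrite // edgesP.
  move=> [v [u [vu /edge_within xD]]] m; rewrite ptE.
  have vu_in : (v, u) \in code_edges c by rewrite -edgesP.
  have m_in : monomials P m \in [seq monomials P m | m <- ords4].
    by rewrite map_f ?mem_ords4.
  move: on_pencil; rewrite all_map => /allP/(_ _ vu_in)/allP/(_ _ m_in).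
  move=> /hasP[[i j] ij_in /allP ks].
  apply/min_attained_twice_pair; exists (i, j) => //; apply/min_boundsP => k k_in.
  by apply: entails_holds (ks k k_in); exact: xD.
- split=> [v w /tp_eqP vw|v u v' u' vu v'u' diff x xF xF'].
    apply/eqP; move: distinct => /all_ords4P/(_ v)/all_ords4P/(_ w) /orP[//|].
    move=> /hasP[i _ /hasP[j _ /negP]]; case; apply/Z.eqb_eq; apply: (@zr_inj R).
    by have := vw i j; rewrite !mxE !zrB.
  rewrite edgesP in vu; rewrite edgesP in v'u'.
  pose eD e := (e, edge_bounds c V e).
  move: disjoint => /allP/(_ _ (map_f eD vu))/allP/(_ _ (map_f eD v'u')).
  rewrite /disjoint_check.
  case: ifP => [/orP[] /andP[/eqP/= e1 /eqP/= e2]|_].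
  - by rewrite e1 e2 eqxx in diff.
  - by rewrite e1 -e2 finset.setUC eqxx in diff.
  rewrite -edgesP in vu; rewrite -edgesP in v'u'.
  move: xF xF' => /(edge_within _ _ _ vu) xF /(edge_within _ _ _ v'u') xF'.
  have [D -> xD] := tighten_all xF xF'.
  move=> /hasP[z _ /and3P[z_end z_end' /all_ords6P at_z]].
  exists z; split.
  - by rewrite !inE; case/orP: z_end => /eqP /= ->; rewrite eqxx ?orbT.
  - by rewrite !inE; case/orP: z_end' => /eqP /= ->; rewrite eqxx ?orbT.
  have le i j : x 0 i - x 0 j <= pos z 0 i - pos z 0 j.
    move: (at_z i) => /all_ords6P/(_ j) at_ij.
    by have := @entails_holds R x D (i, j, gap V z i j) xD at_ij; rewrite /holds /= !mxE zrB.
  by apply/tp_eqP => i j; have := le i j; have := le j i; lra.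
- exact: balanced_code.
Qed.

End WitnessRealizes.

(** * Invariance under isomorphism, and the two shapes *)

Section IsoInvariance.
Import Order.TTheory GRing.Theory Num.Theory.
Local Open Scope ring_scope.
Variables (R : realType) (n : nat) (V : finType) (E F : lgraph n V).

(** The subset stays the same; only the names of its vertices are changed by the permutation. *)
Lemma tropical_line_iso (L : set 'rV[R]_n) : labeled_tree F -> tree_iso F E ->
  tropical_line E L -> tropical_line F L.
Proof.
move=> treeF /tree_isoP[s FE] [_ [pos [[pos_inj meet] [d [d_prim d_sum]] LE]]].
split=> //; exists (pos \o s).
have sV v : inr v = relabel s (inr ((s^-1)%g v)) :> vertex n V by rewrite /= permKV.
have points v w : edge_points (pos \o s) v w = edge_points pos (s v) (relabel s w).
  by case: w.
have dirs v w : edge_dir (pos \o s) v w = edge_dir pos (s v) (relabel s w).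
  by case: w.
have rel_inj : injective (@relabel n V s) := can_inj (relabelK s).
have mem2 (x a b : vertex n V) :
    (relabel s x \in [set relabel s a; relabel s b]%SET) = (x \in [set a; b]%SET).
  by rewrite !inE !(inj_eq rel_inj).
split.
- split=> [u v /pos_inj/perm_inj //|u w u' w' uw u'w' diff x].
  rewrite !points => xuw xu'w'.
  have [|||v [v_uw v_u'w' xv]] := meet (s u) (relabel s w) (s u') (relabel s w') _ _ _ x xuw xu'w'.
  + by rewrite -[inr _]/(relabel s (inr u)) -FE.
  + by rewrite -[inr _]/(relabel s (inr u')) -FE.
  + apply: contra_neq diff => /setP same; apply/setP => y.
    by rewrite -[LHS]mem2 -[RHS]mem2; exact: (same (relabel s y)).
  exists ((s^-1)%g v); rewrite /= permKV; split=> //.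
  + by rewrite -mem2 -sV.
  + by rewrite -mem2 -sV.
- exists (fun v w => d (s v) (relabel s w)); split=> [v w vw|v].
    by rewrite dirs; apply: d_prim; rewrite -[inr _]/(relabel s (inr v)) -FE.
  have [k sum_k] := d_sum (s v); exists k; rewrite -sum_k.
  rewrite [RHS](reindex_inj rel_inj); apply: eq_bigl => w.
  by rewrite FE.
- rewrite LE; apply/seteqP; split=> x /= [v [w [vw xvw]]].
    exists ((s^-1)%g v), (relabel s^-1 w); rewrite FE points /= permKV relabelVK.
    by split=> //; rewrite -[inr _]/(relabel s (inr ((s^-1)%g v))) -sV.
  by exists (s v), (relabel s w); rewrite -points -[inr _]/(relabel s (inr v)) -FE.
Qed.

Lemma caterpillar_iso : tree_iso F E -> caterpillar E -> caterpillar F.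
Proof.
by move=> /tree_isoP[s FE] catE v; have [i vi] := catE (s v); exists i; rewrite FE.
Qed.

Lemma snowflake_iso : tree_iso F E -> snowflake E -> snowflake F.
Proof.
move=> /tree_isoP[s FE] [v vE]; exists ((s^-1)%g v) => i.
by rewrite FE /= permKV.
Qed.

End IsoInvariance.

(** On the path every internal vertex carries a leaf; the center 0 of the star carries none. *)
Lemma caterpillar_code c : cubic c -> caterpillar (code_graph c) <-> ~~ c.1.
Proof.
case: c => star w cub; have leaves t := cubic_attach (t := t) cub.
split=> [/(_ ord0) [i]|/= path v].
  rewrite adj_attach /= => /eqP wi; apply/negP => star_c.
  have : ord0 \in w.
    by rewrite -wi /attach mem_nth // (cubic_size cub).
  by move: cub; rewrite star_c => /perm_mem ->.
have /leaves[i wi] : v \in leaf_word star.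
  by rewrite (negbTE path); elim/ord4_ind: v.
by exists i; rewrite adj_attach /= -wi.
Qed.

Lemma snowflake_code c : cubic c -> snowflake (code_graph c) <-> c.1.
Proof.
move=> cub; split=> [[v no_leaf]|star_c].
  apply: contraT => /(caterpillar_code cub)/(_ v)[i].
  by rewrite (negbTE (no_leaf i)).
exists ord0 => i; rewrite adj_attach /=; apply/eqP => wi.
have : attach c.2 i \in leaf_word c.1.
  case: c cub star_c wi => star w cub _ _.
  by rewrite -(perm_mem cub) mem_nth // (cubic_size cub).
by rewrite wi star_c.
Qed.

(** * The fourteen explicit configurations and the count *)

Definition tree_code (star : bool) (w : seq nat) : bool * seq 'I_4 :=
  (star, [seq nth ord0 ords4 k | k <- w]).

Section Witnesses.
Local Open Scope Z_scope.

(* For each code: the points (x, y, 0), and the positions of the vertices     *)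
(* 0, 1, 2, 3 of their pencil.                                                *)
Definition witnesses : seq ((bool * seq 'I_4) * seq (Z * Z) * seq (seq Z)) :=
  [:: (tree_code false [:: 0; 0; 1; 2; 3; 3]%N,
     [:: (6, 5); (3, 0); (5, 3); (1, 0)],
     [:: [:: 0; 1; 3; 3; 7; 1]; [:: 0; 1; 4; 4; 8; 2];
       [:: 0; 1; 4; 6; 10; 4]; [:: 0; 1; 4; 6; 11; 5]]);
    (tree_code false [:: 0; 0; 1; 3; 3; 2]%N,
     [:: (6, 5); (4, 6); (3, 3); (0, 1)],
     [:: [:: 0; -1; -2; 1; 6; 2]; [:: 0; -1; -1; 2; 7; 3];
       [:: 0; -1; -1; 3; 8; 4]; [:: 0; -1; -1; 4; 9; 4]]);
    (tree_code false [:: 0; 0; 2; 3; 3; 1]%N,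
     [:: (2, 6); (1, 4); (6, 4); (4, 1)],
     [:: [:: 0; -3; -2; -1; 3; 1]; [:: 0; -3; -1; 0; 4; 2];
       [:: 0; -3; 0; 1; 5; 2]; [:: 0; -3; 0; 3; 7; 2]]);
    (tree_code false [:: 0; 0; 3; 3; 2; 1]%N,
     [:: (4, 3); (4, 0); (0, 1); (2, 2)],
     [:: [:: 0; -1; 0; 0; 3; 0]; [:: 0; -1; 1; 1; 4; 1];
       [:: 0; -1; 2; 2; 5; 1]; [:: 0; -1; 3; 3; 5; 1]]);
    (tree_code false [:: 0; 1; 2; 3; 3; 0]%N,
     [:: (0, 2); (4, 2); (1, 1); (2, 0)],
     [:: [:: 0; -2; -1; -1; 1; 0]; [:: 0; -1; 0; 0; 2; 0];
       [:: 0; -1; 1; 1; 3; 0]; [:: 0; -1; 1; 2; 4; 0]]);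
    (tree_code false [:: 0; 1; 3; 3; 2; 0]%N,
     [:: (3, 2); (1, 1); (3, 0); (0, 2)],
     [:: [:: 0; -2; -1; -1; 1; 0]; [:: 0; -1; 0; 0; 2; 0];
       [:: 0; -1; 1; 1; 3; 0]; [:: 0; -1; 2; 2; 3; 0]]);
    (tree_code false [:: 0; 2; 3; 3; 1; 0]%N,
     [:: (4, 1); (3, 2); (1, 4); (4, 4)],
     [:: [:: 0; -3; -1; 0; 4; 1]; [:: 0; -2; 0; 1; 5; 1];
       [:: 0; -1; 1; 2; 5; 1]; [:: 0; -1; 2; 3; 5; 1]]);
    (tree_code false [:: 0; 3; 3; 2; 1; 0]%N,
     [:: (2, 0); (3, 2); (2, 4); (4, 4)],
     [:: [:: 0; -2; 0; 1; 5; 2]; [:: 0; -1; 1; 2; 6; 2];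
       [:: 0; 0; 2; 3; 6; 2]; [:: 0; 1; 3; 3; 6; 2]]);
    (tree_code false [:: 1; 0; 0; 2; 3; 3]%N,
     [:: (1, 0); (0, 2); (3, 6); (5, 3)],
     [:: [:: 0; -1; 0; 0; 3; 0]; [:: 0; -2; -1; 0; 3; 0];
       [:: 0; -2; -1; 2; 5; 2]; [:: 0; -2; -1; 2; 6; 3]]);
    (tree_code false [:: 1; 0; 0; 3; 3; 2]%N,
     [:: (4, 3); (0, 0); (1, 6); (0, 3)],
     [:: [:: 0; -2; -2; -2; 1; 0]; [:: 0; -3; -3; -2; 1; 0];
       [:: 0; -3; -3; -1; 2; 1]; [:: 0; -3; -3; 0; 3; 1]]);
    (tree_code false [:: 2; 0; 0; 1; 3; 3]%N,
     [:: (2, 0); (4, 1); (0, 3); (2, 4)],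
     [:: [:: 0; -1; 1; 1; 2; 0]; [:: 0; -2; 0; 1; 2; 0];
       [:: 0; -3; -1; 0; 2; 0]; [:: 0; -3; -1; 0; 3; 1]]);
    (tree_code false [:: 2; 1; 0; 0; 3; 3]%N,
     [:: (1, 2); (2, 1); (3, 4); (3, 0)],
     [:: [:: 0; 0; 3; 3; 4; 1]; [:: 0; 0; 2; 2; 4; 1];
       [:: 0; -1; 1; 1; 4; 1]; [:: 0; -1; 1; 1; 5; 2]]);
    (tree_code true [:: 1; 1; 2; 2; 3; 3]%N,
     [:: (4, 0); (4, 4); (3, 2); (1, 1)],
     [:: [:: 0; 0; 3; 3; 6; 2]; [:: 0; 0; 2; 2; 5; 1];
       [:: 0; 0; 4; 4; 6; 2]; [:: 0; 0; 3; 3; 7; 3]]);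
    (tree_code true [:: 3; 1; 1; 2; 2; 3]%N,
     [:: (3, 3); (0, 0); (1, 2); (0, 3)],
     [:: [:: 0; -2; -2; -1; 2; 0]; [:: 0; -1; -1; -1; 2; 0];
       [:: 0; -2; -2; 0; 3; 0]; [:: 0; -3; -3; -2; 1; 0]])].

End Witnesses.

Lemma witnesses_check : all (fun w => witness_check w.1.1 w.1.2 w.2) witnesses.
Proof. by vm_compute. Qed.

Lemma witnesses_complete :
  all (fun c => if noncrossing_code c then c \in [seq w.1.1 | w <- witnesses] else true)
    tree_codes.
Proof. by vm_compute. Qed.

Lemma realizable_code (R : realType) c : c \in tree_codes ->
  realizable R (code_graph c) <-> noncrossing_code c.
Proof.
move=> c_in; have := c_in; rewrite mem_tree_codes => /andP[_ cub].
split=> [|nc]; first exact: realizable_noncrossing.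
move: (allP witnesses_complete c c_in); rewrite nc => /mapP[[[c' P] V] /= w_in def_c].
by apply: (witness_realizable _ cub); rewrite def_c; exact: (allP witnesses_check _ w_in).
Qed.

Theorem corollary6p2 (R : realType) :
  [/\ num_classes trivalent6 = 105,
      num_classes (fun E => trivalent6 E /\ realizable R E) = 14,
      num_classes (fun E =>
        [/\ trivalent6 E, realizable R E & caterpillar E]) = 12
    & num_classes (fun E =>
        [/\ trivalent6 E, realizable R E & snowflake E]) = 2].
Proof.
have codeP c : c \in tree_codes -> cubic c /\ trivalent6 (code_graph c).
  by rewrite mem_tree_codes => /andP[_ cub]; split=> //; exact: trivalent6_code.
(* Realizability is transported to the representative of the class, where it is decided. *)
have realP c E : c \in tree_codes -> tree_iso (code_graph c) E -> realizable R E ->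
    noncrossing_code c.
  move=> c_in isoE [P [gen lineE]]; apply/(realizable_code R c_in); exists P.
  split=> //; apply: tropical_line_iso isoE lineE.
  by have [_ []] := codeP c c_in.
have [cnt cnt_path cnt_star] := size_noncrossing_codes.
split.
- rewrite -[RHS]size_tree_codes -count_predT; apply: num_classes_tree_codes.
  + by move=> E.
  + by move=> c c_in _; have [] := codeP c c_in.
  + by move=> c E.
- rewrite -[RHS]cnt; apply: num_classes_tree_codes => [E|c c_in nc|c E c_in isoE].
  + by case.
  + by have [_ tri] := codeP c c_in; split; last exact/realizable_code.
  + by case=> _; exact: realP isoE.
- rewrite -[RHS]cnt_path; apply: num_classes_tree_codes
    => [E|c c_in /andP[nc path]|c E c_in isoE].
  + by case.
  + have [cub tri] := codeP c c_in; split; [by []|exact/realizable_code|].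
    exact/caterpillar_code.
  + case=> _ realE catE; have [cub _] := codeP c c_in.
    apply/andP; split; first exact: realP isoE realE.
    by apply/(caterpillar_code cub); exact: caterpillar_iso isoE catE.
- rewrite -[RHS]cnt_star; apply: num_classes_tree_codes
    => [E|c c_in /andP[nc star]|c E c_in isoE].
  + by case.
  + have [cub tri] := codeP c c_in; split; [by []|exact/realizable_code|].
    exact/snowflake_code.
  + case=> _ realE snowE; have [cub _] := codeP c c_in.
    apply/andP; split; first exact: realP isoE realE.
    by apply/(snowflake_code cub); exact: snowflake_iso isoE snowE.
Qed.
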